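(* Let $P$ and $P'$ be the original and the observed point clouds in $\mathbb{R}^d$, and let persistence diagrams be computed with the Čech filtration. Then for every integer $N$ with $0\le N\le n-2$, $$d_B\big(\bar{\mathrm D}_N(P),\bar{\mathrm D}_N(P')\big)=O_{\mathbb P}(\sqrt d)$$ as $d\to\infty$. Moreover, $d_B(\bar{\mathrm D}_N(P),\bar{\mathrm D}_N(P'))$ is eventually unbounded in probability as $d\to\infty$.
   Context: Setting. Fix integers $n>3$ and $1\le s<n$ and let $d>n$ tend to infinity ($n,s$ do not depend on $d$). The original point cloud is $P=\{x_1,\dots,x_n\}\subset\mathbb{R}^d$ with $x_i=(x_{1i},\dots,x_{si},0,\dots,0)^T$, where the numbers $x_{ki}$ are fixed and do not depend on $d$. The noise point cloud is $E=\{e_1,\dots,e_n\}\subset\mathbb{R}^d$, where all coordinates of all $e_i$ are i.i.d. real random variables with an absolutely continuous distribution (not depending on $d$) of mean $0$ and variance $\nu>0$. The observed point cloud is $P'=\{x_1',\dots,x_n'\}$, $x_i'=x_i+e_i$. Persistence diagrams. For a finite point cloud $X\subset\mathbb{R}^d$ and $r\ge0$, the (ambient) Čech complex at parameter $r$ is the set of $\sigma\subseteq X$ with $\bigcap_{x\in\sigma}B_x(r)\neq\emptyset$ (closed Euclidean balls of radius $r$ in $\mathbb{R}^d$). $\mathrm D_N(X)$ is the $N$-th persistence diagram of this filtration using reduced homology with coefficients in a fixed field: the multiset of birth-death pairs $(b,d)$, $b<d$, in $\mathbb{R}_{\ge0}^2$. $\bar{\mathrm D}_N(X)$ is the disjoint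 union of $\mathrm D_N(X)$ and all points of the diagonal $\{(x,x):x\ge0\}$, each with infinite multiplicity. $d_B(\bar{\mathrm D}_N(X),\bar{\mathrm D}_N(Y))=\inf_\eta\sup_x\|x-\eta(x)\|_\infty$ over all bijections $\eta:\bar{\mathrm D}_N(X)\to\bar{\mathrm D}_N(Y)$. Asymptotic notation. A sequence $X_d$ of random variables is eventually bounded in probability, $X_d=O_{\mathbb P}(1)$, if for every $\varepsilon>0$ there are a constant $C$ and an integer $M$ with $\mathbb P(|X_d|\le C)\ge1-\varepsilon$ for all $d>M$; it is eventually unbounded in probability if it is not eventually bounded in probability. $X_d=O_{\mathbb P}(b_d)$ means $X_d=b_dY_d$ with $Y_d=O_{\mathbb P}(1)$. *)

(* Defs.v *)
From HB Require Import structures.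
From mathcomp Require Import all_boot all_order all_algebra finmap.
From mathcomp Require Import all_classical all_reals all_analysis.
From mathcomp Require Import measurable_realfun.
Import Order.TTheory GRing.Theory Num.Theory.
Import numFieldNormedType.Exports.
Set Implicit Arguments.
Unset Strict Implicit.
Unset Printing Implicit Defensive.
Local Open Scope classical_set_scope.
Local Open Scope ring_scope.

Section Homology.
Variables (F : fieldType) (V : finType).
Implicit Types (K L : pred {set V}) (N : nat).

(* A chain is a formal linear combination of vertex sets; a set of cardinal    *)
(* N.+1 is an N-simplex and set0 is the generator of degree -1. Every simplex  *)
(* is oriented by the enumeration order of V.                                  *)
Definition chain := {ffun {set V} -> F^o}.

Definition simplex (sigma : {set V}) : chain :=
  [ffun tau => ((tau == sigma)%:R : F^o)].

Definition vpos (v : V) (sigma : {set V}) : nat :=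
  #|[pred w in sigma | (enum_rank w < enum_rank v)%N]|.

(* The coefficient of tau in the boundary of c collects the simplices of which *)
(* tau is a facet. Vertices are sent to set0, so homology is reduced.          *)
Definition boundary (c : chain) : chain :=
  [ffun tau : {set V} =>
     \sum_(v | v \notin tau) ((-1) ^+ vpos v tau * c (v |: tau)%SET : F)].

Fact boundary_is_linear : linear boundary.
Proof.
move=> a c c'; apply/ffunP => tau; rewrite !ffunE scaler_sumr -big_split /=.
apply: eq_bigr => v _; rewrite !ffunE mulrDr; congr (_ + _).
exact: mulrCA.
Qed.

HB.instance Definition _ :=
  GRing.isLinear.Build F chain chain _ boundary boundary_is_linear.

Definition chains K N : {vspace chain} :=
  <<[seq simplex sigma | sigma : {set V} <- enum K & #|sigma| == N.+1]>>%VS.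

Definition cycles K N : {vspace chain} :=
  (chains K N :&: lker (linfun boundary))%VS.

Definition boundaries K N : {vspace chain} :=
  (linfun boundary @: chains K N.+1)%VS.

(* The rank of H_N(K) -> H_N(L), for K a subcomplex of L. *)
Definition pbetti K L N : nat :=
  (\dim (cycles K N) - \dim (cycles K N :&: boundaries L N)%VS)%N.

End Homology.

Section Diagrams.
Variables (R : realType) (F : fieldType) (m : nat).
Implicit Types (X Y : {fset 'cV[R]_m}) (p : R * R) (N : nat).

(* The library's norm on matrices is the max norm. *)
Definition eucl_dist (x y : 'cV[R]_m) : R :=
  Num.sqrt (\sum_k (x k ord0 - y k ord0) ^+ 2).

(* For r < 0 the only simplex is the empty one, whose reduced homology         *)
(* vanishes in all degrees N >= 0.                                             *)
Definition cech X (r : R) : pred {set X} :=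
  fun sigma => `[< exists y : 'cV[R]_m,
                     forall x : X, x \in sigma -> eucl_dist (val x) y <= r >].

Definition cech_betti X N (r s : R) : nat := pbetti F (cech r) (@cech X s) N.

(* The number of classes with birth in ]b - eps, b] and death in ]d - eps, d], *)
(* for (b, d) = p and 0 < eps <= d - b.                                        *)
Definition box_count X N p (eps : R) : nat :=
  let: (b, d) := p in
  ((cech_betti X N b (d - eps) + cech_betti X N (b - eps) d)
   - (cech_betti X N (b - eps) (d - eps) + cech_betti X N b d))%N.

(* The multiplicity of p in D_N(X). The complex changes at finitely many       *)
(* parameters only, so box_count is constant for small eps > 0 and the default *)
(* value is never used.                                                        *)
Definition multiplicity X N p : nat :=
  xget 0%N [set k | \forall eps \near 0^'+, box_count X N p eps = k].

(* The diagram together with the diagonal. A multiset is the set of its        *)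
(* numbered copies, so a point of the diagonal has a copy for each natural     *)
(* number.                                                                     *)
Definition diagram X N : set ((R * R) * nat) :=
  [set q | 0 <= q.1.1 < q.1.2 /\ (q.2 < multiplicity X N q.1)%N]
  `|` [set q | 0 <= q.1.1 /\ q.1.1 = q.1.2].

(* The norm on R * R is the max norm. *)
Definition bottleneck (A B : set ((R * R) * nat)) : \bar R :=
  ereal_inf [set ereal_sup [set `|q.1 - (eta q).1|%:E | q in A]
            | eta in [set eta | set_bij A B eta]].

Definition bottleneck_dist N X Y : \bar R :=
  bottleneck (diagram X N) (diagram Y N).

End Diagrams.

Section Probability.
Variables (R : realType) (disp : measure_display) (T : measurableType disp).
Variable P : probability T R.
Implicit Type X : nat -> T -> \bar R.

Definition mutually_independent (I : finType) (X : I -> {RV P >-> R}) :=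
  forall (J : {set I}) (B : I -> set R),
    (forall i, i \in J -> measurable (B i)) ->
    P [set w | forall i, i \in J -> B i (X i w)] =
    (\prod_(i in J) P (X i @^-1` B i))%E.

(* P is only meaningful on measurable sets. To make sense without a proof that *)
(* X d is measurable, boundedness asks for an event of large probability       *)
(* inside {|X d| <= C}, whereas unboundedness denies it for the events that    *)
(* contain {|X d| <= C}. For measurable X d these are the usual notions, and   *)
(* each is the negation of the other, as shown by the two lemmas below.        *)
Definition bounded_in_prob X :=
  forall eps : R, 0 < eps -> exists (C : R) (M : nat), forall d, (M < d)%N ->
    exists A : set T, [/\ measurable A, A `<=` [set w | (`|X d w| <= C%:E)%E]
                        & ((1 - eps)%:E <= P A)%E].

Definition unbounded_in_prob X :=
  ~ forall eps : R, 0 < eps -> exists (C : R) (M : nat), forall d, (M < d)%N ->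
    forall A : set T, measurable A -> [set w | (`|X d w| <= C%:E)%E] `<=` A ->
      ((1 - eps)%:E <= P A)%E.

Let measurable_abs_le X (C : R) d : measurable_fun [set: T] (X d) ->
  measurable [set w | (`|X d w| <= C%:E)%E].
Proof.
move=> mX; rewrite -[X in measurable X]setTI.
exact: (emeasurable_fun_infty_c _ (measurableT_comp _ mX)).
Qed.

Lemma bounded_in_probE X : (forall d, measurable_fun [set: T] (X d)) ->
  bounded_in_prob X <->
  forall eps : R, 0 < eps -> exists (C : R) (M : nat), forall d, (M < d)%N ->
    ((1 - eps)%:E <= P [set w | (`|X d w| <= C%:E)%E])%E.
Proof.
move=> mX; split => bX eps eps0; have [C [M CM]] := bX _ eps0; exists C, M => d Md.
  have [A [mA AX PA]] := CM d Md.
  apply: (le_trans PA); apply: le_measure => //; rewrite inE //.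
  exact: measurable_abs_le.
by exists [set w | (`|X d w| <= C%:E)%E]; split => //;
  [exact: measurable_abs_le | exact: CM].
Qed.

Lemma unbounded_in_probE X : (forall d, measurable_fun [set: T] (X d)) ->
  unbounded_in_prob X <-> ~ bounded_in_prob X.
Proof.
move=> mX; rewrite bounded_in_probE// /unbounded_in_prob.
split; apply: contra_not => bX eps eps0; have [C [M CM]] := bX _ eps0;
  exists C, M => d Md.
  move=> A mA XA; apply: (le_trans (CM d Md)).
  by apply: le_measure => //; rewrite inE //; exact: measurable_abs_le.
by apply: (CM d Md) => //; apply: measurable_abs_le.
Qed.

(* Only large d matter: the factorization is not required for small d. *)
Definition bigO_prob (b : nat -> R) X :=
  exists Y : nat -> T -> \bar R, bounded_in_prob Y /\
    \forall d \near \oo, forall w, (X d w = (b d)%:E * Y d w)%E.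

End Probability.

Section PointClouds.
Variables (R : realType) (n s : nat) (x : 'M[R]_(s, n)).

(* Column i of x holds the s possibly nonzero coordinates of the i-th point. *)
Definition orig_point (d : nat) (i : 'I_n) : 'cV[R]_d :=
  \col_k oapp (fun j : 'I_s => x j i) 0 (insub (val k)).

Definition orig_cloud (d : nat) : {fset 'cV[R]_d} :=
  [fset orig_point d i | i in 'I_n]%fset.

Definition observed_cloud (d : nat) (noise : 'I_n -> 'I_d -> R) :
  {fset 'cV[R]_d} :=
  [fset (orig_point d i + \col_k noise i k)%R | i in 'I_n]%fset.

End PointClouds.

(* Main.v *)
(* All points of a Čech diagram have coordinates between 0 and the largest norm
   of a point of the cloud. Exchanging the off-diagonal points of the two
   diagrams with copies of (0, 0) therefore bounds the bottleneck distance by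
   the largest norm, which is O_P(sqrt d) by Markov's inequality.

   For the lower bound, the laws of large numbers for <e_i, e_j> show that with
   large probability the observed points are nearly orthogonal vectors of norm
   about sqrt(nu d), hence nearly the vertices of a regular simplex. A set of k of
   them then enters the Čech complex near sqrt(nu d (1 - 1/k)). Hence there is a gap
   of order sqrt d between the entry of the last N-simplex and that of the first
   (N+1)-simplex, and an N-dimensional class lives across this gap. Its point of
   the diagram is far from the diagonal and from the bounded diagram of the
   original cloud. Only second moments are available, so the law of large numbers
   for |e_i|^2 goes through truncation. *)
Require Import Defs.
From mathcomp Require Import all_boot all_order all_algebra finmap.
From mathcomp Require Import all_classical all_reals all_analysis.
From mathcomp Require Import measurable_realfun ring lra zify.
Import Order.TTheory GRing.Theory Num.Theory.
Import numFieldNormedType.Exports.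
Set Implicit Arguments.
Unset Strict Implicit.
Unset Printing Implicit Defensive.
Local Open Scope classical_set_scope.
Local Open Scope ring_scope.

(** * Simplicial homology *)

Lemma vposU1 (V : finType) (u v : V) (t : {set V}) : v \notin t ->
  vpos u (v |: t)%SET = ((enum_rank v < enum_rank u) + vpos u t)%N.
Proof.
have vposE s : vpos u s = (\sum_(w in s) (enum_rank w < enum_rank u))%N.
  rewrite /vpos -[LHS]sum1_card big_mkcondr/=.
  by apply: eq_bigr => w _; case: ltnP.
by move=> vt; rewrite !vposE big_setU1.
Qed.

(** Terms are indexed by ordered pairs of distinct vertices outside [t]; by [vposU1], exchanging the
    two vertices flips the sign. *)
Lemma boundaryK (F : fieldType) (V : finType) (c : chain F V) :
  boundary (boundary c) = 0.
Proof.
apply/ffunP => t; rewrite !ffunE.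
under eq_bigr => v vt do rewrite ffunE mulr_sumr.
rewrite (eq_bigr (fun v => \sum_(w | (w \notin t) && (w != v))
   (-1) ^+ vpos v t * ((-1) ^+ vpos w (v |: t)%SET * c (w |: (v |: t))%SET))); last first.
  move=> v vt; apply: eq_bigl => w.
  by rewrite !inE negb_or andbC.
rewrite pair_big_dep /=.
pose G (p : V * V) : F := (-1) ^+ vpos p.1 t * ((-1) ^+ vpos p.2 (p.1 |: t)%SET *
   c (p.2 |: (p.1 |: t))%SET).
pose D (p : V * V) := [&& p.1 \notin t, p.2 \notin t & p.2 != p.1].
rewrite -[LHS]/(\sum_(p | D p) G p).
(* Pairs in decreasing order are reindexed by the swap, so that each meets its partner and
   cancels. *)
rewrite (bigID (fun p : V * V => (enum_rank p.1 < enum_rank p.2)%N))/=.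
rewrite [X in _ + X](reindex_inj (h := fun p : V * V => (p.2, p.1))) /=; last first.
  by move=> [a b] [c' d'] [-> ->].
rewrite [X in _ + X](eq_bigl (fun p : V * V => D p && (enum_rank p.1 < enum_rank p.2)%N)).
  rewrite -big_split big1 //= => -[v w] /andP[/and3P[/= vt wt wv] vw].
  rewrite /G/= (finset.setUCA [set v]%SET) !vposU1// vw.
  have -> : (enum_rank w < enum_rank v)%N = false by apply/negbTE; rewrite -leqNgt ltnW.
  by rewrite add1n exprS add0n; ring.
move=> [v w]; rewrite /D/= andbCA eq_sym.
case: (eqVneq v w) => [->|vw]; first by rewrite !andbF.
rewrite -leqNgt leq_eqVlt (inj_eq val_inj) (inj_eq enum_rank_inj) (negPf vw) //.
Qed.

Section Complexes.
Variables (F : fieldType) (V : finType).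
Implicit Types (K L : pred {set V}).

Lemma simplex_chains K N (s : {set V}) : K s -> #|s| = N.+1 ->
  simplex F s \in chains F K N.
Proof.
move=> Ks sN; apply: memv_span; apply: map_f.
by rewrite mem_filter sN eqxx mem_enum.
Qed.

Lemma chains_sub K N (U : {vspace chain F V}) :
  (forall s, K s -> #|s| = N.+1 -> simplex F s \in U) -> (chains F K N <= U)%VS.
Proof.
move=> KU; apply/span_subvP => _ /mapP[s + ->].
by rewrite mem_filter mem_enum => /andP[/eqP sN Ks]; exact: KU.
Qed.

Lemma chains0 K N : (forall s : {set V}, #|s| = N.+1 -> ~~ K s) -> chains F K N = 0%VS.
Proof.
move=> KN; apply/eqP; rewrite -subv0; apply: chains_sub => s Ks /KN.
by rewrite Ks.
Qed.

Lemma boundaries0 K N : (forall s : {set V}, #|s| = N.+2 -> ~~ K s) -> boundaries F K N = 0%VS.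
Proof. by move=> KN; rewrite /boundaries chains0// limg0. Qed.

Lemma chain_sum (c : chain F V) : c = \sum_s c s *: simplex F s.
Proof.
apply/ffunP => t; rewrite sum_ffunE (bigD1 t)//= !ffunE eqxx big1 ?addr0.
  by rewrite -[RHS]/(c t * 1) mulr1.
by move=> s st; rewrite !ffunE eq_sym (negPf st) scaler0.
Qed.

(** A boundary is killed by [boundaryK] and is supported on sets of N+1 vertices, all of which lie
    in [L]. *)
Lemma boundaries_sub_cycles K L N : (forall s : {set V}, #|s| = N.+1 -> L s) ->
  (boundaries F K N <= cycles F L N)%VS.
Proof.
move=> LN; rewrite subv_cap; apply/andP; split; last first.
  apply/subvP => _ /memv_imgP[c _ ->]; rewrite memv_ker !lfunE/=.
  by rewrite boundaryK.
rewrite /boundaries /chains limg_span; apply/span_subvP => _ /mapP[_ /mapP[s sK ->] ->].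
move: sK; rewrite mem_filter => /andP[/eqP sN _].
rewrite lfunE /= (chain_sum (boundary _)); apply: memv_suml => t _.
have [tN|tN] := eqVneq #|t| N.+1.
  by apply: memvZ; apply: simplex_chains => //; exact: LN.
rewrite ffunE big1 ?scale0r ?mem0v// => v vt; rewrite ffunE.
rewrite [_ == _](_ : _ = false) ?mulr0//; apply/negbTE/eqP => vts.
by move: sN; rewrite -vts cardsU1 vt add1n => -[] /eqP; rewrite (negPf tN).
Qed.

(** Only one vertex completes a given facet to [s], so the coefficient of the boundary of [s] there
    is a sign, hence nonzero. *)
Lemma boundaries_neq0 K N (s : {set V}) : K s -> #|s| = N.+2 ->
  boundaries F K N != 0%VS.
Proof.
move=> Ks sN; apply/eqP => B0.
have : linfun (@boundary F V) (simplex F s) \in boundaries F K N.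
  by apply: memv_img; apply: simplex_chains.
rewrite B0 memv0 lfunE/= => /eqP /ffunP.
have /card_gt0P[v vs] : (0 < #|s|)%N by rewrite sN.
move/(_ (s :\ v)%SET); rewrite !ffunE (bigD1 v) ?finset.setD11//= big1 ?addr0.
  rewrite ffunE finset.setD1K// eqxx mulr1 => /eqP.
  by rewrite expf_eq0 oppr_eq0 oner_eq0 andbF.
move=> w /andP[ws wv]; rewrite ffunE; case: eqP => [E|_]; last by rewrite mulr0.
have : w \in s by rewrite -E finset.setU11.
by move: ws; rewrite !inE wv /= => /negbTE ->.
Qed.

End Complexes.

(* This is the multiplicity of (b, d) in terms of the complexes at b and d (Kb, Kd)
   and just before (Lb, Ld), see multiplicityE; taking the first d at which
   boundaries appear and then the first b at which they are cycles avoids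
   summing multiplicities over a quadrant. *)
Lemma pbetti_first_death (F : fieldType) (V : finType) (Kb Lb Kd Ld : pred {set V}) N :
  boundaries F Ld N = 0%VS ->
  (cycles F Lb N :&: boundaries F Kd N)%VS = 0%VS ->
  (cycles F Kb N :&: boundaries F Kd N)%VS != 0%VS ->
  (0 < (pbetti F Kb Ld N + pbetti F Lb Kd N) - (pbetti F Lb Ld N + pbetti F Kb Kd N))%N.
Proof.
move=> BLd ZLb; rewrite -dimv_eq0 /pbetti BLd ZLb !capv0 dimv0 !subn0.
have := dimvS (capvSl (cycles F Kb N) (boundaries F Kd N)).
move: (\dim _) (\dim _) (\dim _) => i z l; lia.
Qed.

(** * The Čech filtration *)

Definition sqdist (R : realType) (m : nat) (x y : 'cV[R]_m) : R :=
  \sum_k (x k ord0 - y k ord0) ^+ 2.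

Lemma eucl_dist_le (R : realType) (m : nat) (x y : 'cV[R]_m) (r : R) : 0 <= r ->
  (eucl_dist x y <= r) = (sqdist x y <= r ^+ 2).
Proof.
move=> r0; rewrite -[RHS](ler_sqrt (sqdist x y)) ?sqr_ge0//.
by rewrite sqrtr_sqr ger0_norm.
Qed.

Lemma near0_right (R : realType) (Q : R -> Prop) :
  (\forall e \near 0^'+, Q e) -> exists2 e0, 0 < e0 & forall e, 0 < e < e0 -> Q e.
Proof.
move=> [e0 /= e0_gt0 H]; exists e0 => // e /andP[e_gt0 ee0]; apply: H => //=.
by rewrite sub0r normrN gtr0_norm.
Qed.

Section CechFiltration.
Variables (R : realType) (m : nat) (X : {fset 'cV[R]_m}).
Implicit Types (r : R) (s : {set X}).

Lemma cech_mono r r' s : r <= r' -> cech r s -> cech r' s.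
Proof.
by move=> rr' /asboolP[y ys]; apply/asboolP; exists y => x /ys/le_trans; exact.
Qed.

Lemma cech_ge0 r s : s != finset.set0 -> cech r s -> 0 <= r.
Proof.
move=> /set0Pn[x xs] /asboolP[y] /(_ _ xs); apply: le_trans.
exact: sqrtr_ge0.
Qed.

Lemma cech_set0 r : cech r (@finset.set0 X).
Proof. by apply/asboolP; exists 0 => x; rewrite inE. Qed.

(** Compactness: centres for radii slightly above [r] stay in a bounded box, so a centre for [r]
    itself exists. Right-continuity of the filtration rests on this. *)
Lemma cech_closed r s : (forall e, 0 < e -> cech (r + e) s) -> cech r s.
Proof.
have [->|s0] := eqVneq s finset.set0; first by rewrite cech_set0.
move=> re; have r0 : 0 <= r.
  rewrite leNgt; apply/negP => r0.
  have : 0 <= r + (- r / 2) by apply: (cech_ge0 s0); apply: re; lra.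
  by lra.
have [x0 x0s] := set0Pn _ s0.
(* f is twice the total excess of the squared distances over r^2: it attains its
   minimum on a box containing the admissible centres, and this minimum is 0. *)
pose f (y : 'rV[R]_m) : R :=
  \sum_(x in s) (`|sqdist (val x) y^T - r ^+ 2| + (sqdist (val x) y^T - r ^+ 2)).
(* [B] bounds the coordinates of every centre at distance at most [r + 1] from [x0]. *)
pose B := r + 1 + \sum_k `|(val x0) k ord0|.
pose A := [set y : 'rV[R]_m | forall i, y ord0 i \in `[-B, B]].
have cA : compact A.
  apply: (@rV_compact _ _ (fun=> `[- B, B]%classic)) => _.
  exact: segment_compact.
have B0 : 0 <= B by rewrite /B addr_ge0 ?sumr_ge0//; lra.
have A0 : A !=set0 by exists 0 => i /=; rewrite mxE in_itv/=; lra.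
have cf : continuous f.
  have csq (x : X) : continuous (fun y : 'rV[R]_m => sqdist (val x) y^T - r ^+ 2).
    have csq0 : continuous (fun y : 'rV[R]_m => sqdist (val x) y^T); last first.
      by move=> y; apply: (@continuousB R R 'rV[R]_m (fun y => sqdist (val x) y^T)
        (fun=> r ^+ 2)); [exact: csq0|exact: cst_continuous].
    rewrite /sqdist; apply: (@continuous_big R _ _ _ _ _ 'rV[R]_m _
      (fun k (y : 'rV[R]_m) => (val x k ord0 - y^T k ord0) ^+ 2)) => [|k _ z];
      first exact: add_continuous.
    have -> : (fun y : 'rV[R]_m => (val x k ord0 - y^T k ord0) ^+ 2) =
        (fun z : R => z ^+ 2) \o (fun y : 'rV[R]_m => val x k ord0 - y ord0 k).
      by apply/funext => y /=; rewrite mxE.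
    apply: continuous_comp; last exact: exprn_continuous.
    by apply: (@continuousB R R 'rV[R]_m (fun=> val x k ord0)
      (fun y => y ord0 k)); [exact: cst_continuous|exact: coord_continuous].
  apply: (@continuous_big R _ _ _ _ _ 'rV[R]_m _ (fun (x : X) (y : 'rV[R]_m) =>
    `|sqdist (val x) y^T - r ^+ 2| + (sqdist (val x) y^T - r ^+ 2))) => [|x _ y]; first exact: add_continuous.
  apply: (@continuousD R R 'rV[R]_m (fun y => `|sqdist (val x) y^T - r ^+ 2|)
    (fun y => sqdist (val x) y^T - r ^+ 2)); last exact: csq.
  by apply: continuous_comp; [exact: csq|exact: norm_continuous].
have [|c cA' cmin] := compact_EVT_min A0 cA (f := f).
  exact: continuous_subspaceT.
have f_ge0 (t : R) : 0 <= `|t| + t by have := ler_norm (- t); rewrite normrN; lra.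
(* A centre for [r + e] has squared excess at most [e * (2 * r + 1)] at each point, so the minimum
   of [f] is of order [e]. *)
have fc e : 0 < e -> e <= 1 -> f c <= e * (2 * #|s|%:R * (2 * r + 1)).
  move=> e0 e1; have /asboolP[y ys] := re e e0.
  have yA : y^T \in A.
    rewrite inE => i /=; rewrite mxE in_itv/= -ler_norml.
    have := ys _ x0s; rewrite eucl_dist_le; last lra.
    rewrite /sqdist (bigD1 i)//= => h.
    have : `|val x0 i ord0 - y i ord0| <= r + e.
      rewrite -(@ler_pXn2r _ 2) ?nnegrE//; last lra.
      by rewrite real_normK ?num_real// (le_trans _ h)// lerDl sumr_ge0// => *; exact: sqr_ge0.
    rewrite distrC => h1; have := ler_normD (y i ord0 - val x0 i ord0) (val x0 i ord0).
    rewrite subrK => h2.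
    have : `|val x0 i ord0| <= \sum_k `|(val x0) k ord0|.
      by rewrite (bigD1 i)//= lerDl sumr_ge0.
    by rewrite /B; lra.
  apply: (le_trans (cmin _ yA)).
  apply: (@le_trans _ _ (\sum_(x in s) (e * (2 * (2 * r + 1))))).
    apply: ler_sum => x xs; rewrite trmxK.
    have := ys _ xs; rewrite eucl_dist_le; last lra.
    set q := sqdist _ _ => qr.
    have ee : e * e <= e by rewrite ler_piMr // ltW.
    have h : q - r ^+ 2 <= e * (2 * r + 1) by rewrite expr2 in qr *; lra.
    have : `|q - r ^+ 2| + (q - r ^+ 2) <= Num.max 0 (2 * (q - r ^+ 2)).
      by rewrite le_max; case: (ger0P (q - r^+2)) => ?; apply/orP; [right|left]; lra.
    move=> /le_trans; apply; rewrite ge_max; apply/andP; split; last lra.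
    by rewrite !mulr_ge0//; lra.
  by rewrite sumr_const -mulr_natr; lra.
have fc0 : f c <= 0.
  rewrite leNgt; apply/negP => fc_gt0.
  pose C := 2 * #|s|%:R * (2 * r + 1) + 1.
  have C0 : 1 <= C by rewrite /C lerDr !mulr_ge0//; lra.
  (* This choice would force [f c] below [f c / 2]. *)
  pose e := Num.min 1 (f c / (2 * C)).
  have e0 : 0 < e by rewrite lt_min ltr01/= divr_gt0//; lra.
  have := fc e e0; rewrite ge_min lexx => /(_ isT) h.
  have : e * C <= f c / 2.
    have : e <= f c / (2 * C) by rewrite ge_min lexx orbT.
    by rewrite ler_pdivlMr; lra.
  by rewrite /C in h *; lra.
apply/asboolP; exists c^T => x xs; rewrite eucl_dist_le// -subr_le0.
have : `|sqdist (val x) c^T - r ^+ 2| + (sqdist (val x) c^T - r ^+ 2) <= 0.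
  apply: le_trans fc0; rewrite /f (bigD1 x)//= lerDl; apply: sumr_ge0 => x' _; exact: f_ge0.
have := normr_ge0 (sqdist (val x) c^T - r ^+ 2); have := ler_norm (sqdist (val x) c^T - r ^+ 2).
lra.
Qed.

(** The left limit of the filtration: with finitely many simplices it agrees with [cech (r - e)] for
    all small [e > 0], which turns the limit in [multiplicity] into a formula. *)
Definition cech_left r : pred {set X} :=
  fun s => `[< exists2 r', r' < r & cech r' s >].

Lemma cech_left_near r : \forall e \near 0^'+, cech (r - e) = cech_left r.
Proof.
suff : \forall e \near 0^'+, forall s : {set X}, cech (r - e) s = cech_left r s.
  by apply: filterS => e H; apply/funext.
apply: filter_forall => s; have [/asboolP[r' r'r sr']|sr] := boolP (cech_left r s).
  near=> e; apply: (cech_mono _ sr').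
  by rewrite lerBrDr -lerBrDl; near: e; apply: nbhs_right_le; rewrite subr_gt0.
near=> e; apply/negbTE; apply: contra sr => sr; apply/asboolP; exists (r - e) => //.
by rewrite ltrBlDr ltrDl; near: e; exact: nbhs_right_gt.
Unshelve. all: by end_near. Qed.

(** By [cech_closed] an absent simplex stays absent slightly longer, and there are finitely many
    simplices. *)
Lemma cech_right_near r : \forall e \near 0^'+, cech (r + e) = cech r :> pred {set X}.
Proof.
suff : \forall e \near 0^'+, forall s : {set X}, cech (r + e) s = cech r s.
  by apply: filterS => e H; apply/funext.
apply: filter_forall => s; have [sr|sr] := boolP (cech r s).
  near=> e; apply: (cech_mono _ sr).
  by rewrite lerDl; near: e; exact: nbhs_right_ge.
have [e0 e0_gt0 sre0] : exists2 e0, 0 < e0 & ~~ cech (r + e0) s.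
  apply: contrapT => H; move/negP: sr; apply; apply: cech_closed => e e0.
  by apply: contrapT => /negP h; apply: H; exists e.
near=> e; apply/negbTE; apply: contra sre0; apply: cech_mono.
by rewrite lerD2l; near: e; exact: nbhs_right_le.
Unshelve. all: by end_near. Qed.

(** The radius is the infimum of those satisfying [Q]. The complex is constant just to its right, so
    [Q] is attained; its left limit is the complex at a smaller radius, where [Q] fails. *)
Lemma cech_first (Q : pred {set X} -> Prop) r0 : Q (cech r0) ->
  (forall r, r < 0 -> ~ Q (cech r)) ->
  exists r, [/\ 0 <= r, r <= r0, Q (cech r) & ~ Q (cech_left r)].
Proof.
move=> Qr0 Q0; pose S := [set r | Q (cech r)].
have S0 : lbound S 0.
  by move=> r Sr; rewrite leNgt; apply/negP => r0'; exact: (Q0 r).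
have iS : has_inf S by split; [exists r0|exists 0].
have Sge r : S r -> inf S <= r by move=> Sr; apply: ge_inf => //; exists 0.
exists (inf S); split.
- exact: lb_le_inf iS.1 S0.
- exact: Sge.
- have [e0 e0_gt0 He0] := near0_right (cech_right_near (inf S)).
  have [r Sr rS] : exists2 r, S r & r < inf S + e0.
    by apply: inf_adherent => //; exact: iS.
  have [<-//|Ir] := eqVneq r (inf S).
  have {}Ir : inf S < r by rewrite lt_neqAle eq_sym Ir Sge.
  by rewrite -(He0 (r - inf S)) ?subrKC ?subr_gt0 ?Ir// ltrBlDl.
- have [e0 e0_gt0 He0] := near0_right (cech_left_near (inf S)).
  rewrite -(He0 (e0 / 2)) => [/Sge|]; last by lra.
  by lra.
Qed.
End CechFiltration.

(** * Multiplicities and critical radii *)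

Section Multiplicity.
Variables (R : realType) (F : fieldType) (m : nat) (X : {fset 'cV[R]_m}).
Implicit Types (b d r : R).

Lemma multiplicityE N b d :
  multiplicity F X N (b, d) =
  ((pbetti F (cech b) (@cech_left _ _ X d) N + pbetti F (@cech_left _ _ X b) (cech d) N)
   - (pbetti F (@cech_left _ _ X b) (cech_left d) N + pbetti F (@cech _ _ X b) (cech d) N))%N.
Proof.
rewrite /multiplicity; case: xgetP => [k _ /= kP|/= H]; last first.
  exfalso; apply: H; near=> e; rewrite /box_count /cech_betti.
  have -> : @cech _ _ X (b - e) = cech_left b by near: e; exact: cech_left_near.
  have -> : @cech _ _ X (d - e) = cech_left d by near: e; exact: cech_left_near.
  reflexivity.
have [e [<- [be de]]] : exists e, [/\ box_count F X N (b, d) e = k,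
    @cech _ _ X (b - e) = cech_left b & @cech _ _ X (d - e) = cech_left d].
  apply: (@filter_ex _ (0^'+ : set_system R)); near=> e; split; near: e => //.
  - exact: cech_left_near.
  - exact: cech_left_near.
by rewrite /box_count /cech_betti be de.
Unshelve. all: by end_near. Qed.

Definition critical r := exists s : {set X}, cech r s /\ forall r', r' < r -> ~~ cech r' s.

Lemma noncritical r : ~ critical r -> @cech _ _ X r = cech_left r.
Proof.
move=> ncr; apply/funext => s; apply/idP/asboolP => [rs|[r' r'r sr']]; last first.
  by apply: cech_mono sr'; exact: ltW.
apply: contrapT => H; apply: ncr; exists s; split=> // r' r'r.
by apply/negP => sr'; apply: H; exists r'.
Qed.

(** Where no simplex enters, the complex equals its left limit and the alternating sum of
    [multiplicityE] cancels. *)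
Lemma multiplicity_critical N b d : (0 < multiplicity F X N (b, d))%N ->
  critical b /\ critical d.
Proof.
rewrite multiplicityE => mult; split; apply: contrapT => /noncritical H; move: mult.
  by rewrite H addnC subnn.
by rewrite H addnC subnn.
Qed.

(** At radius [r0] the origin is a centre for the whole cloud, so nothing enters later. The empty
    simplex is present at all radii and has no entry radius, whence nonnegativity. *)
Lemma critical_bounded r0 r : 0 <= r0 ->
  (forall x, x \in X -> eucl_dist x 0 <= r0) -> critical r -> 0 <= r <= r0.
Proof.
move=> r0_ge0 Xr0 [s [rs sr]]; apply/andP; split.
  apply: (cech_ge0 _ rs); apply: contraPneq sr => ->.
  by move/(_ (r - 1)); rewrite cech_set0 => H; suff : false by []; apply: H; lra.
rewrite leNgt; apply/negP => /sr /negP; apply; apply/asboolP; exists 0 => x _.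
exact/Xr0/valP.
Qed.

(** Each of the finitely many simplices enters at most once. *)
Lemma critical_finite : finite_set critical.
Proof.
have -> : (critical : set R) = \bigcup_(s in [set: {set X}])
    [set r | cech r s /\ forall r', r' < r -> ~~ cech r' s].
  by apply/seteqP; split => [r [s H]|r [s _ H]]; exists s.
apply: bigcup_finite => [|s _]; first exact: finite_finset.
have [[r0 Hr0]|H] := pselect (exists r, cech r s /\ forall r', r' < r -> ~~ cech r' s).
  apply: (@sub_finite_set _ _ [set r0]) => // r [rs sr] /=.
  case: Hr0 => r0s sr0; case: (ltgtP r r0) => // h.
    by have := sr0 _ h; rewrite rs.
  by have := sr _ h; rewrite r0s.
apply: (@sub_finite_set _ _ set0) => // r Hr; apply: H; by exists r.
Qed.

End Multiplicity.

(** * Bottleneck distance *)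

Section Bottleneck.
Variable R : realType.
Implicit Types (q : (R * R) * nat) (A B : set ((R * R) * nat)).

Definition diagonal : set ((R * R) * nat) := [set q | 0 <= q.1.1 /\ q.1.1 = q.1.2].

Lemma prod_norm_le (p p' : R * R) (C : R) :
  (`|p - p'| <= C) = (`|p.1 - p'.1| <= C) && (`|p.2 - p'.2| <= C).
Proof. by rewrite prod_normE ge_max. Qed.

Let origin : set ((R * R) * nat) := [set q | q.1 = (0, 0)].

Lemma countableU T (A B : set T) : countable A -> countable B -> countable (A `|` B).
Proof.
move=> cA cB; have -> : A `|` B = \bigcup_(b in [set: bool]) (if b then A else B).
  apply/seteqP; split => [t [At|Bt]|t [[] _ H]]; [by exists true|by exists false| |].
    by left.
  by right.
by apply: bigcup_countable => // -[].
Qed.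

(** The infinitely many copies of the origin absorb any countable set, so the off-diagonal parts of
    two diagrams become equinumerous. *)
Lemma setU_origin_nat A : countable A -> (A `|` origin #= [set: nat])%card.
Proof.
move=> cA; apply: eq_card_nat.
  apply: countableU => //.
  have -> : origin = [set (0, 0)] `*` setT.
    by apply/seteqP; split => [[p k] //= -> //|[p k] [/= -> _]].
  exact: countableX.
apply: (@sub_infinite_set _ (range (fun k : nat => ((0 : R, 0 : R), k)))).
  by move=> _ [k _ <-]; right.
rewrite (eq_finite_set (inj_card_eq _)); first exact: infinite_nat.
by move=> i j _ _ [].
Qed.

(* Off-diagonal points are exchanged with copies of the origin. *)
Lemma bottleneck_le (r0 : R) A B : 0 <= r0 ->
  countable A -> countable B ->
  (forall q, A q -> 0 <= q.1.1 < q.1.2 /\ q.1.2 <= r0) ->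
  (forall q, B q -> 0 <= q.1.1 < q.1.2 /\ q.1.2 <= r0) ->
  (bottleneck (A `|` diagonal) (B `|` diagonal) <= r0%:E)%E.
Proof.
move=> r0_ge0 cA cB Ar Br.
have /card_set_bijP[f [ff fi fs]] : (A `|` origin #= B `|` origin)%card.
  by apply: (card_eq_trans (setU_origin_nat cA)); rewrite card_eq_sym; exact: setU_origin_nat.
(* The rest of the diagonal is common to both diagrams; the bijection fixes it and follows [f]
   elsewhere. *)
pose D : set ((R * R) * nat) := diagonal `\` origin.
have DC C : (forall q, C q -> 0 <= q.1.1 < q.1.2 /\ q.1.2 <= r0) ->
    (C `|` diagonal = (C `|` origin) `|` D) /\ (C `|` origin) `&` D = set0.
  move=> Cr; split; apply/seteqP; split => //.
  - move=> q [Cq|dq]; first by left; left.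
    by have [Oq|Oq] := pselect (origin q); [left; right|right].
  - move=> q [[Cq|Oq]|[dq _]]; [by left| |by right].
    by right; rewrite /diagonal/= Oq.
  - move=> q [[Cq|Oq] [dq nOq]]; last exact: nOq.
    by have [] := Cr _ Cq; rewrite dq.2 ltxx andbF.
have [AE AD] := DC _ Ar; have [BE BD] := DC _ Br.
pose eta q := if q \in D then q else f q.
have etaD q : D q -> eta q = q by move=> Dq; rewrite /eta mem_set.
have etaA q : (A `|` origin) q -> eta q = f q.
  move=> Aq; rewrite /eta memNset// => Dq.
  by have : set0 q by rewrite -AD.
have box C q : (forall q, C q -> 0 <= q.1.1 < q.1.2 /\ q.1.2 <= r0) ->
    (C `|` origin) q -> 0 <= q.1.1 <= r0 /\ 0 <= q.1.2 <= r0.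
  move=> Cr [/Cr[/andP[h1 h2] h3]|->/=]; last by rewrite lexx r0_ge0.
  by split; lra.
apply: (@le_trans _ _ (ereal_sup [set `|q.1 - (eta q).1|%:E | q in A `|` diagonal])).
  apply: ereal_inf_lbound; exists eta => //=; rewrite AE BE; split.
  - move=> q /= [Aq|Dq]; first by rewrite etaA//; left; exact: ff.
    by rewrite etaD//; right.
  - move=> p q /set_mem[Ap|Dp] /set_mem[Aq|Dq].
    + by rewrite !etaA//; apply: fi; exact: mem_set.
    + rewrite etaA// (etaD q)// => fpq; exfalso.
      by have : set0 q by rewrite -BD; split => //; rewrite -fpq; exact: ff.
    + rewrite (etaD p)// etaA// => fpq; exfalso.
      by have : set0 p by rewrite -BD; split => //; rewrite fpq; exact: ff.
    + by rewrite !etaD.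
  - move=> q [Bq|Dq]; last by exists q; [right|rewrite etaD].
    have [p Ap <-] := fs _ Bq.
    by exists p; [left|rewrite etaA].
apply: ge_ereal_sup => _ [q Aq <-]; rewrite lee_fin.
rewrite AE in Aq; case: Aq => [Aq|Dq]; last by rewrite etaD// subrr normr0.
rewrite etaA// prod_norm_le.
have [h1 h2] := box _ _ Ar Aq; have [h3 h4] := box _ _ Br (ff _ Aq).
by rewrite !ler_norml; apply/andP; split; lra.
Qed.

(** Every bijection sends some [p] to [q], and this single move already costs [C]. *)
Lemma bottleneck_gt (C : R) A B q : B q ->
  (forall p, A p -> C <= `|p.1 - q.1|) -> (C%:E <= bottleneck A B)%E.
Proof.
move=> Bq AC; apply: le_ereal_inf_tmp => _ [eta [ef ei es] <-].
have [p Ap pq] := es _ Bq.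
apply: (@le_trans _ _ `|p.1 - (eta p).1|%:E).
  by rewrite lee_fin pq; exact: AC.
by apply: ereal_sup_ubound; exists p.
Qed.

End Bottleneck.

Section BottleneckDist.
Variables (R : realType) (F : fieldType) (m : nat) (N : nat).
Implicit Types (X Y : {fset 'cV[R]_m}).

Let offdiag X := [set q : (R * R) * nat | 0 <= q.1.1 < q.1.2 /\
  (q.2 < multiplicity F X N q.1)%N].

Let offdiag_critical X q : offdiag X q -> critical X q.1.1 /\ critical X q.1.2.
Proof.
case: q => -[b d] k [_ /= kN]; apply: (@multiplicity_critical _ F _ _ N).
exact: leq_ltn_trans kN.
Qed.

(** Coordinates of off-diagonal points are critical radii, hence finite in number and at most
    [r0]. *)
Lemma bottleneck_dist_le X Y (r0 : R) : 0 <= r0 ->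
  (forall x, x \in X -> eucl_dist x 0 <= r0) ->
  (forall x, x \in Y -> eucl_dist x 0 <= r0) ->
  (bottleneck_dist F N X Y <= r0%:E)%E.
Proof.
move=> r0_ge0 Xr Yr.
have cnt Z : countable (offdiag Z).
  apply: (@sub_countable _ _ _ ((critical Z `*` critical Z) `*` [set: nat])).
    apply: subset_card_le => -[[b d] k] /offdiag_critical[cb cd].
    by split.
  apply: countableX => //; apply: countableX; apply: finite_set_countable; exact: critical_finite.
apply: (bottleneck_le r0_ge0 (cnt X) (cnt Y)) => q oq; split; try by case: oq.
  by have [_ /(critical_bounded r0_ge0 Xr)/andP[]] := offdiag_critical oq.
by have [_ /(critical_bounded r0_ge0 Yr)/andP[]] := offdiag_critical oq.
Qed.

(** The point [(b, d)] is far from the diagram of [X], whose deaths are at most [r0], and from the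
    diagonal, whose max-norm distance to it is half of [d - b]. *)
Lemma bottleneck_dist_ge X Y (r0 C b d : R) : 0 <= r0 ->
  (forall x, x \in X -> eucl_dist x 0 <= r0) ->
  0 <= b -> (0 < multiplicity F Y N (b, d))%N ->
  r0 + C <= d -> 2 * C <= d - b -> 0 < C ->
  (C%:E <= bottleneck_dist F N X Y)%E.
Proof.
move=> r0_ge0 Xr b0 mult dC dbC C0.
apply: (@bottleneck_gt _ _ _ _ ((b, d), 0%N)).
  by left; split => //=; lra.
move=> p [op|dp].
  have [_ /(critical_bounded r0_ge0 Xr)/andP[p0 pr]] := offdiag_critical op.
  have := lexx `|p.1 - (b, d)|; rewrite {1}prod_norm_le /= !ler_norml => /andP[_ /andP[]].
  by lra.
have := lexx `|p.1 - (b, d)|; rewrite {1}prod_norm_le /= !ler_norml dp.2.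
by move=> /andP[/andP[? ?] /andP[? ?]]; lra.
Qed.

End BottleneckDist.

(** * Nearly orthogonal clouds *)

Definition dotv (R : realType) (m : nat) (u v : 'cV[R]_m) : R :=
  \sum_k u k ord0 * v k ord0.

Section NearlyOrthogonal.
Variables (R : realType) (F : fieldType) (m : nat) (X : {fset 'cV[R]_m}) (D t : R).
(** The Gram matrix is entrywise within [t] of [D] times the identity, the Gram matrix of orthogonal
    vectors of squared norm [D]. *)
Hypothesis dotX : forall u v : X, `|dotv (val u) (val v) - (u == v)%:R * D| <= t.

Let dot_ge (u v : X) : (u == v)%:R * D - t <= dotv (val u) (val v).
Proof. by have := dotX u v; rewrite ler_norml => /andP[]; lra. Qed.

Let dot_le (u v : X) : dotv (val u) (val v) <= (u == v)%:R * D + t.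
Proof. by have := dotX u v; rewrite ler_norml => /andP[]; lra. Qed.

Let sum_delta (s : {set X}) (u : X) (c : R) : u \in s ->
  \sum_(v in s) ((u == v)%:R * D + c) = D + #|s|%:R * c.
Proof.
move=> us; rewrite big_split/= sumr_const mulr_natl; congr (_ + _).
rewrite (bigD1 u)//= eqxx mul1r big1 ?addr0// => v /andP[_ /negbTE].
by rewrite eq_sym => ->; rewrite mul0r.
Qed.

Let row_ge (s : {set X}) (u : X) : u \in s ->
  D - #|s|%:R * t <= \sum_(v in s) dotv (val u) (val v).
Proof. by move=> us; rewrite -mulrN -(sum_delta _ us); apply: ler_sum. Qed.

Let row_le (s : {set X}) (u : X) : u \in s ->
  \sum_(v in s) dotv (val u) (val v) <= D + #|s|%:R * t.
Proof. by move=> us; rewrite -(sum_delta _ us); apply: ler_sum. Qed.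

Let total_le (s : {set X}) :
  \sum_(u in s) \sum_(v in s) dotv (val u) (val v) <= #|s|%:R * (D + #|s|%:R * t).
Proof. by rewrite mulr_natl -sumr_const; apply: ler_sum => u; exact: row_le. Qed.

Let total_sq (s : {set X}) :
  \sum_(u in s) \sum_(v in s) dotv (val u) (val v) =
  \sum_k (\sum_(u in s) val u k ord0) ^+ 2.
Proof.
rewrite /dotv; under eq_bigr do rewrite exchange_big/=.
rewrite exchange_big/=; apply: eq_bigr => k _.
by rewrite expr2 mulr_suml; apply: eq_bigr => u _; rewrite mulr_sumr.
Qed.

(** The centroid is a common centre. Its squared distance to a vertex combines a Gram entry, a row
    sum and the total sum, with errors t, 2t and t. *)
Lemma cech_centroid (s : {set X}) (k : nat) (r : R) : #|s| = k.+1 -> 0 <= r ->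
  D * (1 - k.+1%:R^-1) + 4 * t <= r ^+ 2 -> cech r s.
Proof.
move=> sk r0 hr; apply/asboolP.
pose c : 'cV[R]_m := \col_j (k.+1%:R^-1 * \sum_(v in s) val v j ord0).
exists c => u us; rewrite eucl_dist_le//; apply: le_trans hr.
have -> : sqdist (val u) c = dotv (val u) (val u)
   - 2 * k.+1%:R^-1 * (\sum_(v in s) dotv (val u) (val v))
   + k.+1%:R^-1 ^+ 2 * \sum_(v in s) \sum_(w in s) dotv (val v) (val w).
  rewrite total_sq /sqdist /dotv exchange_big/= !mulr_sumr -sumrB -big_split/=.
  by apply: eq_bigr => j _; rewrite -mulr_sumr mxE; ring.
have K0 : 0 < k.+1%:R^-1 :> R by rewrite invr_gt0 ltr0n.
have KK : k.+1%:R^-1 * k.+1%:R = 1 :> R by rewrite mulVf// pnatr_eq0.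
have h1 : dotv (val u) (val u) <= D + t by have := dot_le u u; rewrite eqxx mul1r.
have h2 : k.+1%:R^-1 * (D - k.+1%:R * t) <= k.+1%:R^-1 * \sum_(v in s) dotv (val u) (val v).
  by rewrite ler_pM2l// -sk row_ge.
have h3 : k.+1%:R^-1 ^+ 2 * (\sum_(v in s) \sum_(w in s) dotv (val v) (val w))
  <= k.+1%:R^-1 ^+ 2 * (k.+1%:R * (D + k.+1%:R * t)).
  by rewrite ler_pM2l ?exprn_gt0// -sk total_le.
move: h2 h3; rewrite mulrBr (mulrA _ _ t) KK mul1r.
rewrite (_ : k.+1%:R^-1 ^+ 2 * (k.+1%:R * (D + k.+1%:R * t)) = k.+1%:R^-1 * D + t).
  by move: (k.+1%:R^-1) => i; move: (\sum_(_ in _) _) => S1; move: (\sum_(_ in _) _) => S2; lra.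
by rewrite expr2 -mulrA (mulrA _ k.+1%:R) KK mul1r mulrDr mulrA KK mul1r.
Qed.

(** The largest squared distance to a centre is at least the mean one, which is minimal at the
    centroid; there the diagonal and the total of the Gram matrix each contribute an error t. *)
Lemma cech_radius_ge (s : {set X}) (k : nat) (r : R) : #|s| = k.+1 ->
  cech r s -> D * (1 - k.+1%:R^-1) - 2 * t <= r ^+ 2.
Proof.
move=> sk rs.
have /card_gt0P[x0 x0s] : (0 < #|s|)%N by rewrite sk.
have r0 : 0 <= r by apply: (cech_ge0 _ rs); apply/set0Pn; exists x0.
move/asboolP : rs => [y ys].
have K0 : 0 < k.+1%:R :> R by rewrite ltr0n.
have KK : k.+1%:R^-1 * k.+1%:R = 1 :> R by rewrite mulVf// pnatr_eq0.
have h1 : \sum_(u in s) sqdist (val u) y <= k.+1%:R * r ^+ 2.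
  rewrite -sk mulr_natl -sumr_const; apply: ler_sum => u us.
  by rewrite -eucl_dist_le// ys.
have h2 : \sum_(u in s) dotv (val u) (val u)
    - k.+1%:R^-1 * (\sum_(u in s) \sum_(v in s) dotv (val u) (val v))
    <= \sum_(u in s) sqdist (val u) y.
  rewrite total_sq /dotv /sqdist exchange_big/= [leRHS]exchange_big/= mulr_sumr -sumrB.
  apply: ler_sum => j _; set S := \sum_(u in s) val u j ord0.
  have -> : \sum_(u in s) (val u j ord0 - y j ord0) ^+ 2 =
      \sum_(u in s) val u j ord0 * val u j ord0 - 2 * y j ord0 * S + k.+1%:R * y j ord0 ^+ 2.
    rewrite -sk (mulr_natl _ #|s|) -sumr_const /S mulr_sumr -sumrB -big_split/=.
    by apply: eq_bigr => u _; ring.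
  (* The variance identity in coordinate [j]: the difference is a multiple of a square. *)
  rewrite -subr_ge0.
  rewrite [leRHS](_ : _ = k.+1%:R^-1 * (k.+1%:R * y j ord0 - S) ^+ 2).
    by apply: mulr_ge0; [rewrite invr_ge0 ltW|exact: sqr_ge0].
  by field; rewrite nat1r pnatr_eq0.
have h3 : k.+1%:R * (D - t) <= \sum_(u in s) dotv (val u) (val u).
  rewrite -sk mulr_natl -sumr_const; apply: ler_sum => u us.
  by have := dot_ge u u; rewrite eqxx mul1r.
have h4 : k.+1%:R^-1 * (\sum_(u in s) \sum_(v in s) dotv (val u) (val v))
    <= D + k.+1%:R * t.
  by rewrite [leLHS]mulrC ler_pdivrMr// [leRHS]mulrC -sk total_le.
rewrite -(ler_pM2l K0).
have -> : k.+1%:R * (D * (1 - k.+1%:R^-1) - 2 * t) = k.+1%:R * (D - t) - (D + k.+1%:R * t).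
  by field; rewrite nat1r pnatr_eq0.
by apply: le_trans h1; apply: le_trans h2; exact: lerB.
Qed.

(** Take [d] as the first radius with nonzero boundaries in degree N and [b] as the first one whose
    cycles meet the boundaries at [d]. Below [rb] there is no (N+1)-simplex, so [rb <= d]; at [ra]
    all N-simplices are present, so the boundaries at [d] are cycles and [b <= ra]. *)
Lemma exists_long_bar (N : nat) (ra rb : R) : (N.+2 <= #|` X|)%N -> 0 <= ra ->
  ra < rb -> D * (1 - N.+1%:R^-1) + 4 * t <= ra ^+ 2 ->
  rb ^+ 2 <= D * (1 - N.+2%:R^-1) - 2 * t ->
  exists b d, [/\ 0 <= b, b <= ra, rb <= d & (0 < multiplicity F X N (b, d))%N].
Proof.
move=> NX ra0 rarb hra hrb.
have [s sN] : exists s : {set X}, #|s| = N.+2.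
  have : (0 < #|[set s : {set X} | #|s| == N.+2]%SET|)%N.
    by rewrite card_draws bin_gt0 -cardfE.
  by move=> /card_gt0P[s]; rewrite inE => /eqP sN; exists s.
(* Some radius at which the origin is a centre for all points, so that the search for [d]
   succeeds. *)
pose r1 := \sum_(x : X) eucl_dist (val x) 0.
have r1s : cech r1 s.
  apply/asboolP; exists 0 => x _; rewrite /r1 (bigD1 x)//= lerDl sumr_ge0// => *.
  exact: sqrtr_ge0.
have neg0 (r : R) (s' : {set X}) j : r < 0 -> #|s'| = j.+1 -> ~~ cech r s'.
  move=> r0 s'j; apply/negP => /cech_ge0.
  by rewrite -card_gt0 s'j => /(_ isT); lra.
have [d [d0 dr1 Bd Bd']] := @cech_first _ _ _ (fun K => boundaries F K N != 0%VS) r1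
  (boundaries_neq0 F r1s sN)
  (fun r r0 => negP (introT negPn (introT eqP (boundaries0 F (fun s' => neg0 r s' N.+1 r0))))).
have rbd : rb <= d.
  rewrite leNgt; apply/negP => drb; move/negP: Bd; apply; apply/eqP.
  apply: boundaries0 => s' s'N; apply/negP => /(cech_radius_ge s'N) h.
  have : d ^+ 2 < rb ^+ 2 by rewrite ltr_pXn2r// nnegrE; lra.
  by rewrite ltNge (le_trans hrb h).
have full (s' : {set X}) : #|s'| = N.+1 -> cech ra s' by move=> s'N; exact: cech_centroid hra.
have [|r r0|b [b0 bra Zb Zb']] := @cech_first _ _ _
    (fun K => (cycles F K N :&: boundaries F (@cech _ _ X d) N)%VS != 0%VS) ra.
- by rewrite (capv_idPr _)// boundaries_sub_cycles.
- by rewrite /cycles chains0 ?cap0v ?eqxx// => s' /neg0; exact.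
exists b, d; split => //; rewrite multiplicityE.
by apply: pbetti_first_death => //; apply/eqP/negPn/negP.
Qed.
End NearlyOrthogonal.

(** * Inner products under perturbation *)

Section Dot.
Variables (R : realType) (m : nat).
Implicit Types u v a b : 'cV[R]_m.

Lemma dotvDD a u b v :
  dotv (a + u) (b + v) = dotv a b + dotv a v + dotv b u + dotv u v.
Proof.
rewrite /dotv -!big_split/=; apply: eq_bigr => k _; rewrite !mxE; ring.
Qed.

Lemma dotv_young u v (eta : R) : 0 < eta ->
  `|dotv u v| <= (eta^-1 * dotv u u + eta * dotv v v) / 2.
Proof.
move=> eta0; rewrite /dotv !mulr_sumr -big_split/= mulr_suml.
apply: (le_trans (ler_norm_sum _ _ _)); apply: ler_sum => k _.
move: (u k ord0) (v k ord0) => y z.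
have h (c : R) : 0 <= eta^-1 * (y + eta * z * c) ^+ 2.
  by rewrite mulr_ge0 ?sqr_ge0// invr_ge0 ltW.
have e1 (c : R) : eta^-1 * (y + eta * z * c) ^+ 2 =
    eta^-1 * (y * y) + 2 * y * z * c + eta * (z * z) * c ^+ 2.
  by field; rewrite gt_eqF.
rewrite ler_norml; apply/andP; split.
  by have := h 1; rewrite e1; lra.
by have := h (-1); rewrite e1; lra.
Qed.

(** The weight [eta] splits each cross term into a part from the fixed vectors and a part
    proportional to the noise, which a small [eta] makes negligible. *)
Lemma dotv_perturb a b u v (rho eta S : R) : 0 < eta ->
  dotv a a <= rho -> dotv b b <= rho -> dotv u u <= S -> dotv v v <= S ->
  `|dotv (a + u) (b + v) - dotv u v| <= rho + eta^-1 * rho + eta * S.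
Proof.
move=> eta0 ha hb hu hv; rewrite dotvDD addrK.
have := dotv_young a b ltr01; rewrite invr1 !mul1r => h1.
have := dotv_young a v eta0; have := dotv_young b u eta0 => h2 h3.
have e0 : 0 < eta^-1 by rewrite invr_gt0.
have := ler_wpM2l (ltW e0) ha; have := ler_wpM2l (ltW e0) hb.
have := ler_wpM2l (ltW eta0) hu; have := ler_wpM2l (ltW eta0) hv => k1 k2 k3 k4.
have := ler_normD (dotv a b + dotv a v) (dotv b u).
have := ler_normD (dotv a b) (dotv a v).
lra.
Qed.

Lemma dotv_eucl u : eucl_dist u 0 = Num.sqrt (dotv u u).
Proof. by congr Num.sqrt; apply: eq_bigr => k _; rewrite mxE subr0 expr2. Qed.

End Dot.

(** * Deterministic bounds for the observed cloud *)

Section Clouds.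
Variables (R : realType) (F : fieldType) (n s : nat) (x : 'M[R]_(s, n)).

Definition sqnorm_total : R := \sum_i \sum_j x j i ^+ 2.

Lemma sqnorm_total_ge0 : 0 <= sqnorm_total.
Proof. by apply: sumr_ge0 => i _; apply: sumr_ge0 => j _; exact: sqr_ge0. Qed.

(** Each row of [x] fills at most one of the [d] coordinates, so the bound is uniform in [d]. *)
Lemma orig_point_le d i : dotv (orig_point x d i) (orig_point x d i) <= sqnorm_total.
Proof.
apply: (@le_trans _ _ (\sum_j x j i ^+ 2)); last first.
  rewrite /sqnorm_total (bigD1 i)//= lerDl; apply: sumr_ge0 => i' _.
  by apply: sumr_ge0 => j _; exact: sqr_ge0.
(* Each coordinate becomes a sum over the rows of the same index, which has at most one term, so
   that the sums can be exchanged. *)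
have -> : dotv (orig_point x d i) (orig_point x d i) =
    \sum_(k < d) \sum_(j < s | val j == val k) x j i ^+ 2.
  apply: eq_bigr => k _; rewrite !mxE; case: insubP => [j ks jk|nks] /=.
    rewrite (big_pred1 j) ?expr2// => j'.
    by rewrite [RHS]/= -[RHS](inj_eq val_inj) jk.
  rewrite mul0r big1// => j /eqP jk.
  by move: nks; rewrite -[val k]jk ltn_ord.
rewrite (exchange_big_dep xpredT)//=; apply: ler_sum => j _.
rewrite sumr_const -[leRHS]mulr1n ler_wpMn2l ?sqr_ge0//.
rewrite -[1%N](card1 (T := 'I_s) j).
have [jd|jd] := ltnP j d.
  apply: (@leq_trans #|pred1 (Ordinal jd)|); last by rewrite !card1.
  apply: subset_leq_card; apply/fintype.subsetP => k; rewrite !inE => /eqP jk.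
  by apply/eqP/val_inj.
rewrite eq_card0// => k; rewrite !inE; apply/negbTE/eqP => jk.
by move: jd; rewrite jk leqNgt ltn_ord.
Qed.

Definition noise_vec d (noise : 'I_n -> 'I_d -> R) (i : 'I_n) : 'cV[R]_d :=
  \col_k noise i k.

Lemma orig_cloud_norm d z : z \in orig_cloud x d ->
  eucl_dist z 0 <= Num.sqrt sqnorm_total.
Proof.
by move=> /imfsetP[i _ ->]; rewrite dotv_eucl ler_wsqrtr// orig_point_le.
Qed.

Lemma bottleneck_dist_cloud_le N d noise (S : R) : 0 <= S ->
  (forall i, dotv (@noise_vec d noise i) (noise_vec noise i) <= S) ->
  (bottleneck_dist F N (orig_cloud x d) (observed_cloud x noise)
     <= (Num.sqrt (2 * sqnorm_total + 2 * S))%:E)%E.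
Proof.
move=> S0 hS; apply: bottleneck_dist_le; first exact: sqrtr_ge0.
  move=> z /orig_cloud_norm /le_trans; apply; apply: ler_wsqrtr.
  by have := sqnorm_total_ge0; lra.
move=> z /imfsetP[i _ ->]; rewrite dotv_eucl; apply: ler_wsqrtr.
rewrite dotvDD; have := dotv_young (orig_point x d i) (noise_vec noise i) ltr01.
rewrite invr1 !mul1r ler_norml => /andP[_ h]; have := hS i; have := orig_point_le d i.
by move: h; rewrite /noise_vec; lra.
Qed.

(* The gap nu (1/(N+1) - 1/(N+2)) between the squared entry radii, divided by d,
   is 24 times this tolerance. *)
Definition noise_tol (N : nat) (nu : R) : R := nu / (24 * N.+1%:R * N.+2%:R).

Lemma noise_tol_gt0 (N : nat) (nu : R) : 0 < nu -> 0 < noise_tol N nu.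
Proof. by move=> nu0; rewrite divr_gt0// !mulr_gt0// ltr0n. Qed.

(** Near orthogonality passes from the noise to the observed points at twice the tolerance;
    [exists_long_bar] then gives a class whose death and lifetime grow like sqrt d. *)
Lemma bottleneck_dist_cloud_ge (N : nat) (nu C : R) : (N.+2 <= n)%N -> 0 < nu -> 0 < C ->
  exists M : nat, forall d, (M < d)%N ->
  forall noise : 'I_n -> 'I_d -> R,
  (forall i j, `|dotv (noise_vec noise i) (noise_vec noise j) - (i == j)%:R * (nu * d%:R)|
     <= noise_tol N nu * d%:R) ->
  (C%:E <= bottleneck_dist F N (orig_cloud x d) (observed_cloud x noise))%E.
Proof.
move=> Nn nu0 C0; move: (noise_tol_gt0 N nu0); move delE : (noise_tol N nu) => del del0.
have := sqnorm_total_ge0; have := orig_point_le; have := orig_cloud_norm.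
move: sqnorm_total => rho cloud_norm point_le rho0.
(* Makes the noise part of the perturbation exactly [del * d / 2]. *)
pose eta := del / (2 * (nu + del)).
have eta0 : 0 < eta by rewrite divr_gt0// mulr_gt0// addr_gt0.
(* Squared radii divided by d: by [a2] all N-simplices are present, and before [b2] no (N+1)-simplex
   is. With tolerance [2 * del] the errors 4t and 2t use up half of the gap [24 * del]. *)
pose a2 := nu * (1 - N.+1%:R^-1) + 8 * del.
pose b2 := nu * (1 - N.+2%:R^-1) - 4 * del.
have N1 : 0 < N.+1%:R^-1 :> R by rewrite invr_gt0 ltr0n.
have N1' : N.+1%:R^-1 <= 1 :> R by rewrite invf_le1 ?ltr0n// ler1n.
have a2_gt0 : 0 < a2.
  by rewrite ltr_wpDl ?mulr_gt0 ?mulr_ge0 ?subr_ge0// ltW.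
have ab2 : a2 < b2.
  have -> : b2 = a2 + 12 * del.
    rewrite /b2 /a2 -delE /noise_tol; field.
    by rewrite !nat1r -!natrD !pnatr_eq0.
  by lra.
have tol_le : 24 * del <= nu.
  rewrite -delE /noise_tol mulrA ler_pdivrMr ?mulr_gt0 ?ltr0n// (mulrC _ nu) ler_pM2l//.
  by rewrite -mulrA ler_peMr// -natrM ler1n.
pose a := Num.sqrt a2; pose b := Num.sqrt b2.
have ab : a < b by rewrite ltr_sqrt//; lra.
have a_ge0 : 0 <= a by exact: sqrtr_ge0.
pose r0 := Num.sqrt rho.
have r00 : 0 <= r0 by exact: sqrtr_ge0.
(* Once sqrt d reaches [L], the death is at least [r0 + C] and the lifetime at least [2 * C]. *)
pose L := (r0 + C) / b + 2 * C / (b - a).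
have b0 : 0 < b by lra.
have L0 : 0 <= L by rewrite addr_ge0// divr_ge0//; lra.
(* The first summand gives [L <= sqrt d], the second puts the fixed part of the perturbation below
   [del * d / 2]. *)
pose K := L ^+ 2 + 2 * (rho + eta^-1 * rho) / del.
exists (Num.trunc K) => d Md noise hn.
have Kd : K <= d%:R.
  by rewrite ltW// (lt_le_trans (truncnS_gt _))// ler_nat.
have t0 : 0 <= 2 * (rho + eta^-1 * rho) / del.
  by rewrite divr_ge0 ?(ltW del0)// mulr_ge0// addr_ge0// mulr_ge0// invr_ge0 ltW.
have dL : L <= Num.sqrt d%:R.
  rewrite -[L]ger0_norm// -sqrtr_sqr ler_wsqrtr//.
  by apply: le_trans Kd; rewrite /K lerDl.
have drho : rho + eta^-1 * rho <= del * d%:R / 2.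
  have : 2 * (rho + eta^-1 * rho) / del <= d%:R.
    by apply: le_trans Kd; rewrite /K lerDr sqr_ge0.
  by rewrite ler_pdivrMr//; lra.
have d0 : 0 <= d%:R :> R by rewrite ler0n.
have d_gt0 : 0 < d%:R :> R by rewrite ltr0n; case: d Md {noise hn Kd dL drho d0}.
have nn i : dotv (noise_vec noise i) (noise_vec noise i) <= (nu + del) * d%:R.
  by have := hn i i; rewrite eqxx mul1r ler_norml => /andP[_]; rewrite mulrDl; lra.
pose p i := orig_point x d i + \col_k noise i k.
have hp i j : `|dotv (p i) (p j) - (i == j)%:R * (nu * d%:R)| <= 2 * del * d%:R.
  have h := dotv_perturb eta0 (point_le d i) (point_le d j) (nn i) (nn j).
  have e1 : eta * ((nu + del) * d%:R) = del * d%:R / 2.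
    by rewrite /eta; field; apply: lt0r_neq0; lra.
  rewrite e1 in h; have := ler_normD (dotv (p i) (p j) - dotv (noise_vec noise i) (noise_vec noise j))
    (dotv (noise_vec noise i) (noise_vec noise j) - (i == j)%:R * (nu * d%:R)).
  rewrite addrA subrK => /le_trans; apply.
  apply: (le_trans (lerD h (hn i j))); lra.
(* Two coinciding points would have an inner product close both to 0 and to nu d. Hence the cloud
   has n points and indices can be read off points. *)
have pinj : injective p.
  move=> i j pij; apply/eqP/negPn/negP => ij.
  have := hp i j; rewrite (negPf ij) mul0r subr0 -pij => h1.
  have := hp i i; rewrite eqxx mul1r ler_norml => /andP[h2 _].
  move: h1; rewrite ler_norml => /andP[_ h1].
  have : 24 * del * d%:R <= nu * d%:R by rewrite ler_pM2r.
  have : 0 < del * d%:R by rewrite mulr_gt0.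
  by lra.
have cardX : #|` observed_cloud x noise| = n.
  by rewrite card_imfset//= -[RHS]card_ord cardE.
have [||||||b' [d' [b'0 b'r rd' mult]]] := @exists_long_bar R F d (observed_cloud x noise)
    (nu * d%:R) (2 * del * d%:R) _ N (a * Num.sqrt d%:R) (b * Num.sqrt d%:R).
- move=> u v; have /imfsetP[i _ ui] := valP u; have /imfsetP[j _ vj] := valP v.
  rewrite ui vj -(inj_eq val_inj) ui vj -/(p i) -/(p j) (inj_eq pinj).
  exact: hp.
- by rewrite cardX.
- by rewrite mulr_ge0// sqrtr_ge0.
- by rewrite ltr_pM2r// sqrtr_gt0.
- rewrite exprMn !sqr_sqrtr//; last exact: ltW.
  by rewrite /a2 le_eqVlt; apply/orP; left; apply/eqP; ring.
- rewrite exprMn !sqr_sqrtr//; last lra.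
  by rewrite /b2 le_eqVlt; apply/orP; left; apply/eqP; ring.
apply: (bottleneck_dist_ge r00 _ b'0 mult) => //.
- by move=> z /cloud_norm.
- apply: le_trans rd'; rewrite mulrC -ler_pdivrMr//; apply: le_trans dL.
  by rewrite /L lerDl divr_ge0//; lra.
- have : 2 * C <= (b - a) * Num.sqrt d%:R; last by rewrite mulrBl; lra.
  rewrite [leRHS]mulrC -ler_pdivrMr ?subr_gt0//; apply: le_trans dL.
  by rewrite /L lerDr divr_ge0//; lra.
Qed.
End Clouds.

(** * Independence *)

Section Independence.
Context (R : realType) (disp : measure_display) (T : measurableType disp).
Variable P : probability T R.

Definition independent (d1 d2 : measure_display) (T1 : measurableType d1)
    (T2 : measurableType d2) (U : T -> T1) (V : T -> T2) :=
  forall A B, measurable A -> measurable B ->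
    P (U @^-1` A `&` V @^-1` B) = (P (U @^-1` A) * P (V @^-1` B))%E.

Lemma independent_comp (d1 d2 e1 e2 : measure_display) (T1 : measurableType d1)
    (T2 : measurableType d2) (S1 : measurableType e1) (S2 : measurableType e2)
    (U : T -> T1) (V : T -> T2) (f : T1 -> S1) (g : T2 -> S2) :
  measurable_fun setT f -> measurable_fun setT g ->
  independent U V -> independent (f \o U) (g \o V).
Proof.
move=> mf mg UV A B mA mB; apply: (UV (f @^-1` A) (g @^-1` B)).
  by rewrite -[X in measurable X]setTI; exact: mf.
by rewrite -[X in measurable X]setTI; exact: mg.
Qed.

(** Dynkin's lemma: rectangles generate the product sigma-algebra and are stable under intersection,
    and the identity passes to complements and disjoint unions. *)
Lemma independent_event_pair (d1 d2 : measure_display) (T1 : measurableType d1)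
    (T2 : measurableType d2) (U : T -> T1) (V : T -> T2) (E : set T) :
  measurable_fun setT U -> measurable_fun setT V -> measurable E ->
  (forall A B, measurable A -> measurable B ->
    P (E `&` (U @^-1` A `&` V @^-1` B)) = (P E * P (U @^-1` A `&` V @^-1` B))%E) ->
  forall D : set (T1 * T2), measurable D ->
    P (E `&` (fun w => (U w, V w)) @^-1` D) =
    (P E * P ((fun w => (U w, V w)) @^-1` D))%E.
Proof.
move=> mU mV mE EUV; set W := fun w => (U w, V w).
have mW : measurable_fun setT W by exact: measurable_fun_pair.
have mWD D : measurable D -> measurable (W @^-1` D).
  by move=> mD; rewrite -[X in measurable X]setTI; exact: mW.
suff H : forall D, <<s [set A `*` B | A in measurable & B in measurable] >> D ->
    P (E `&` W @^-1` D) = (P E * P (W @^-1` D))%E.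
  by move=> D mD; apply: H; rewrite -measurable_prod_measurableType.
apply: (@dynkin_induction _ (T1 * T2)%type _ (fun D => P (E `&` W @^-1` D) = (P E * P (W @^-1` D))%E)).
- exact: measurable_prod_measurableType.
- move=> _ _ [A1 mA1 [B1 mB1 <-]] [A2 mA2 [B2 mB2 <-]].
  exists (A1 `&` A2); first exact: measurableI.
  by exists (B1 `&` B2); [exact: measurableI|rewrite setXI].
- by rewrite preimage_setT setIT probability_setT mule1.
- by move=> _ [A mA [B mB <-]]; exact: EUV.
- move=> S mS HS; have mWS := mWD _ mS.
  have -> : E `&` W @^-1` (~` S) = E `\` W @^-1` S by rewrite preimage_setC setDE.
  rewrite measureD//; last by rewrite ltey_eq fin_num_measure.
  rewrite [X in (_ - X)%E](HS) preimage_setC probability_setC//.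
  by rewrite muleBr ?mule1// ?fin_num_measure// fin_num_adde_defr.
- move=> S mS tS HS; rewrite preimage_bigcup setI_bigcupr.
  have tW : trivIset setT (fun k => W @^-1` S k).
    apply/trivIsetP => i j _ _ ij; rewrite -preimage_setI.
    by move/trivIsetP : tS => -> //; rewrite preimage_set0.
  rewrite [X in X = _]measure_bigcup/=; last 2 first.
  + by move=> k _; apply: measurableI => //; exact: mWD.
  + exact: trivIset_setIl.
  rewrite [X in _ = (_ * X)%E]measure_bigcup//=; last by move=> k _; exact: mWD.
  rewrite -[P E]fineK ?fin_num_measure// -nneseriesZl// fineK ?fin_num_measure//.
  by apply: eq_eseriesr => k _; exact: HS.
Qed.

(** Rectangles are replaced by arbitrary product-measurable sets in one pair at a time. *)
Lemma independent_pair (d1 d2 d3 d4 : measure_display) (T1 : measurableType d1)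
    (T2 : measurableType d2) (T3 : measurableType d3) (T4 : measurableType d4)
    (U1 : T -> T1) (U2 : T -> T2) (V1 : T -> T3) (V2 : T -> T4) :
  measurable_fun setT U1 -> measurable_fun setT U2 ->
  measurable_fun setT V1 -> measurable_fun setT V2 ->
  (forall A1 A2 B1 B2, measurable A1 -> measurable A2 -> measurable B1 -> measurable B2 ->
    P ((U1 @^-1` A1 `&` U2 @^-1` A2) `&` (V1 @^-1` B1 `&` V2 @^-1` B2)) =
    (P (U1 @^-1` A1 `&` U2 @^-1` A2) * P (V1 @^-1` B1 `&` V2 @^-1` B2))%E) ->
  independent (fun w => (U1 w, U2 w)) (fun w => (V1 w, V2 w)).
Proof.
move=> mU1 mU2 mV1 mV2 H A B mA mB.
have mWB : measurable ((fun w => (V1 w, V2 w)) @^-1` B).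
  by rewrite -[X in measurable X]setTI; apply: measurable_fun_pair.
rewrite setIC muleC; apply: independent_event_pair => // A1 A2 mA1 mA2.
rewrite setIC muleC; apply: independent_event_pair => //.
  by apply: measurableI; rewrite -[X in measurable X]setTI; [exact: mU1|exact: mU2].
by move=> B1 B2 mB1 mB2; exact: H.
Qed.

Section Mutual.
Variables (I : finType) (X : I -> {RV P >-> R}).
Hypothesis indX : mutually_independent X.

Lemma mutually_independent_setU (J1 J2 : {set I}) (B : I -> set R) :
  disjoint (mem J1) (mem J2) -> (forall i, measurable (B i)) ->
  P ([set w | forall i, i \in J1 -> B i (X i w)] `&`
     [set w | forall i, i \in J2 -> B i (X i w)]) =
  (P [set w | forall i, i \in J1 -> B i (X i w)] *
   P [set w | forall i, i \in J2 -> B i (X i w)])%E.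
Proof.
move=> J12 mB; rewrite !indX// -bigU//=.
rewrite (eq_bigl (mem (J1 :|: J2)%SET)) => [|i]; last by rewrite !inE.
rewrite -indX//; congr (P _).
apply/seteqP; split => [w [H1 H2] i|w H].
  by rewrite inE => /orP[/H1|/H2].
by split=> i iJ; apply: H; rewrite inE iJ ?orbT.
Qed.

Lemma mutually_independent2 p q : p != q -> independent (X p) (X q).
Proof.
move=> pq A B mA mB.
pose C i := if i == p then A else B.
have mC i : measurable (C i) by rewrite /C; case: ifP.
have qp : (q == p) = false by rewrite eq_sym; apply/negbTE.
have Ep : [set w | forall i, i \in [set p]%SET -> C i (X i w)] = X p @^-1` A.
  apply/seteqP; split => [w /(_ p)|w Aw i]; first by rewrite inE /C eqxx; exact.
  by rewrite inE => /eqP ->; rewrite /C eqxx.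
have Eq : [set w | forall i, i \in [set q]%SET -> C i (X i w)] = X q @^-1` B.
  apply/seteqP; split => [w /(_ q)|w Bw i]; first by rewrite inE /C eqxx qp; exact.
  by rewrite inE => /eqP ->; rewrite /C qp.
rewrite -Ep -Eq; apply: mutually_independent_setU => //.
by rewrite disjoints1 inE.
Qed.

Lemma mutually_independent4 p q p' q' : uniq [:: p; q; p'; q'] ->
  independent (fun w => (X p w, X q w)) (fun w => (X p' w, X q' w)).
Proof.
rewrite /= !inE !negb_or andbT => /and3P[/and3P[pq pp' pq'] /andP[qp' qq'] p'q'].
apply: independent_pair => // A1 A2 B1 B2 mA1 mA2 mB1 mB2.
(* A single indexed family encodes the four events, as mutual independence requires. *)
pose C i := if i == p then A1 else if i == q then A2 else if i == p' then B1 else B2.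
have mC i : measurable (C i) by rewrite /C; do ?[case: ifP].
have Cp : C p = A1 by rewrite /C eqxx.
have Cq : C q = A2 by rewrite /C eqxx (eq_sym q) (negbTE pq).
have Cp' : C p' = B1 by rewrite /C eqxx !(eq_sym p') (negbTE pp') (negbTE qp').
have Cq' : C q' = B2.
  by rewrite /C !(eq_sym q') (negbTE pq') (negbTE qq') (negbTE p'q').
have E (i j : I) : [set w | forall k, k \in [set i; j]%SET -> C k (X k w)] =
    X i @^-1` C i `&` X j @^-1` C j.
  apply/seteqP; split => [w H|w [Hi Hj] k].
    by split; apply: H; rewrite !inE eqxx ?orbT.
  by rewrite !inE => /orP[] /eqP ->.
rewrite -Cp -Cq -Cp' -Cq' -!E; apply: mutually_independent_setU => //.
rewrite disjoint_subset; apply/fintype.subsetP => k.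
by rewrite !inE negb_or => /orP[] /eqP ->; rewrite ?pp' ?pq' ?qp' ?qq'.
Qed.

End Mutual.
End Independence.

(** * Means *)

(** Integrability is bundled with the value, so that computing with means needs no separate
    integrability arguments. *)
Definition has_mean (R : realType) (disp : measure_display) (T : measurableType disp)
    (P : probability T R) (X : T -> R) (r : R) :=
  P.-integrable setT (EFin \o X) /\ (\int[P]_w (X w)%:E = r%:E)%E.

Section HasMean.
Context (R : realType) (disp : measure_display) (T : measurableType disp).
Variable P : probability T R.
Implicit Types (X Y : T -> R) (r : R).

Lemma has_mean_measurable X r : has_mean P X r -> measurable_fun setT X.
Proof. by move=> [/measurable_int/measurable_EFinP]. Qed.

Lemma measurable_superlevel X (t : R) : measurable_fun setT X ->
  measurable [set w | (t <= X w)%R].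
Proof.
by move=> mX; rewrite -[X in measurable X]setTI; apply: (@measurable_fun_le _ _ _ _ (fun=> t)).
Qed.

Lemma has_mean_cst r : has_mean P (fun=> r) r.
Proof.
split; first exact: finite_measure_integrable_cst.
by have := expectation_cst P r; rewrite unlock.
Qed.

Lemma has_meanD X Y r s : has_mean P X r -> has_mean P Y s ->
  has_mean P (fun w => X w + Y w) (r + s).
Proof.
move=> [iX eX] [iY eY]; split.
  have -> : EFin \o (fun w => X w + Y w) = (EFin \o X) \+ (EFin \o Y) by [].
  exact: integrableD.
by rewrite (@integralD_EFin _ _ _ P) // eX eY.
Qed.

Lemma has_meanZ X r c : has_mean P X r -> has_mean P (fun w => c * X w) (c * r).
Proof.
move=> [iX eX]; split.
  have -> : EFin \o (fun w => c * X w) = (fun w => (c%:E * (EFin \o X) w)%E) by [].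
  exact: integrableZl.
under eq_integral do rewrite EFinM.
by rewrite integralZl// eX.
Qed.

Lemma has_meanB X Y r s : has_mean P X r -> has_mean P Y s ->
  has_mean P (fun w => X w - Y w) (r - s).
Proof.
move=> hX /(has_meanZ (-1)) hY; have := has_meanD hX hY.
rewrite mulN1r; congr has_mean; apply/funext => w; by rewrite mulN1r.
Qed.

Lemma has_mean_sum (I : Type) (l : seq I) (X : I -> T -> R) (r : I -> R) :
  (forall i, has_mean P (X i) (r i)) ->
  has_mean P (fun w => \sum_(i <- l) X i w) (\sum_(i <- l) r i).
Proof.
move=> hX; elim: l => [|i l IH].
  rewrite big_nil; under eq_fun do rewrite big_nil; exact: has_mean_cst.
by rewrite big_cons; under eq_fun do rewrite big_cons; exact: has_meanD.
Qed.

Lemma has_mean_ge0 X (r : R) : measurable_fun setT X -> (forall w, 0 <= X w) ->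
  (\int[P]_w (X w)%:E = r%:E)%E -> has_mean P X r.
Proof.
move=> mX X0 eX; split=> //; apply/integrableP; split; first exact/measurable_EFinP.
under eq_integral do rewrite gee0_abs ?lee_fin ?X0//.
by rewrite eX ltry.
Qed.

Lemma has_mean_dominated X Y r : measurable_fun setT X ->
  (forall w, `|X w| <= Y w) -> has_mean P Y r -> exists s, has_mean P X s.
Proof.
move=> mX XY [iY _].
have iX : P.-integrable setT (EFin \o X).
  apply: le_integrable iY => //; first exact/measurable_EFinP.
  by move=> w _ /=; rewrite lee_fin (le_trans (XY w))// ler_norm.
exists (fine (\int[P]_w (X w)%:E)%E); split => //.
by rewrite fineK//; exact: integrable_fin_num.
Qed.

Lemma has_mean_le X Y r s : (forall w, X w <= Y w) ->
  has_mean P X r -> has_mean P Y s -> r <= s.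
Proof.
by move=> XY [iX eX] [iY eY]; rewrite -lee_fin -eX -eY; apply: le_integral => // w _; rewrite lee_fin.
Qed.

Lemma has_mean_markov X r (t : R) : (forall w, 0 <= X w) -> has_mean P X r -> 0 < t ->
  (P [set w | (t <= X w)%R] <= (r / t)%:E)%E.
Proof.
move=> X0 hX t0; have mX := has_mean_measurable hX.
have mA : measurable [set w | t <= X w].
  exact: measurable_superlevel.
have hA : has_mean P (\1_[set w | (t <= X w)%R]) (fine (P [set w | (t <= X w)%R])).
  apply: has_mean_ge0; first exact: measurable_indic.
    by move=> w; rewrite indicE.
  by have := expectation_indic P mA; rewrite unlock => ->; rewrite fineK ?fin_num_measure.
rewrite -[P _]fineK ?fin_num_measure// lee_fin ler_pdivlMr// mulrC.
apply: has_mean_le (has_meanZ t hA) hX => w; rewrite indicE.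
by have [|_] := boolP (w \in _); [rewrite inE /= mulr1|rewrite mulr0].
Qed.

(** Independence identifies the joint law with the product of the two laws, and Fubini's theorem
    separates the integral. *)
Lemma has_mean_indep (U V : {mfun T >-> R}) a b : independent P U V ->
  has_mean P U a -> has_mean P V b -> has_mean P (fun w => U w * V w) (a * b).
Proof.
move=> UV [iU eU] [iV eV].
pose PU := distribution P U; pose PV := distribution P V.
pose W := fun w => (U w, V w).
have mW : measurable_fun setT W by exact: measurable_fun_pair.
pose W' : {mfun T >-> (R * R)%type} := mfun_Sub (mem_set mW).
have WE D : measurable D -> (PU \x PV)%E D = distribution P W' D.
  apply: product_measure_unique => A B mA mB.
  exact: UV.
pose f (z : R * R) : \bar R := (z.1 * z.2)%:E.
have mf : measurable_fun setT f.
  apply/measurable_EFinP; apply: measurable_funM; [exact: measurable_fst|exact: measurable_snd].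
have iPU : PU.-integrable setT (EFin : R -> \bar R).
  exact: integrable_pushforward.
have iPV : PV.-integrable setT (EFin : R -> \bar R).
  exact: integrable_pushforward.
have ePU : (\int[PU]_y y%:E = a%:E)%E.
  by rewrite /PU integral_distribution.
have ePV : (\int[PV]_y y%:E = b%:E)%E.
  by rewrite /PV integral_distribution.
have iaPU := integrable_abse iPU; have iaPV := integrable_abse iPV.
have fPV : (\int[PV]_y `|y%:E| \is a fin_num)%E := integrable_fin_num measurableT iaPV.
have fPU : (\int[PU]_y `|y%:E| \is a fin_num)%E := integrable_fin_num measurableT iaPU.
(* Tonelli's criterion: the iterated integral of the absolute value is the product of two finite
   ones. *)
have iprod : (PU \x PV)%E.-integrable setT f.
  apply/integrable12ltyP => //.
  have -> : (\int[PU]_u \int[PV]_v `|f (u, v)|)%E =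
      (\int[PU]_u ((fine (\int[PV]_v `|v%:E|))%:E * `|u%:E|))%E.
    apply: eq_integral => u _; rewrite fineK// muleC /f/=.
    rewrite -(integralZl measurableT iaPV).
    by apply: eq_integral => v _; rewrite /= normrM EFinM.
  rewrite (integralZl measurableT iaPU) -(fineK fPU) -EFinM.
  exact: ltry.
have iW : (distribution P W').-integrable setT f.
  apply/integrableP; split => //; have /integrableP[_] := iprod.
  by rewrite (eq_measure_integral (distribution P W')) // => A mA _; exact: WE.
have iUV : P.-integrable setT (f \o W').
  apply/integrableP; split; first exact: measurableT_comp.
  have /integrableP[_] := iW; rewrite ge0_integral_distribution//.
  exact: measurableT_comp.
split => //.
rewrite -[LHS]/(\int[P]_w (f \o W') w)%E -integral_distribution//.
rewrite (eq_measure_integral (PU \x PV)%E) => [|A mA _]; last exact: (esym (WE A mA)).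
rewrite -integral12_prod_meas1//.
transitivity (\int[PU]_u (b%:E * u%:E))%E; last by rewrite integralZl// ePU mulrC.
apply: eq_integral => u _; rewrite /fubini_F /f /= muleC -ePV -integralZl//.
Qed.

(* Laws are compared with that of another variable: a measure on measurableTypeR R
   is not one on R, as these two measurable types have different displays. *)
Lemma has_mean_law (X Y : {RV P >-> R}) (f : R -> R) r :
  (forall A : set R, measurable A -> distribution P X A = distribution P Y A) ->
  measurable_fun setT f -> has_mean P (f \o Y) r -> has_mean P (f \o X) r.
Proof.
move=> XY mf [/integrableP[_ iY] eY].
have e (g : R -> \bar R) :
    (\int[distribution P X]_y g y = \int[distribution P Y]_y g y)%E.
  by apply: eq_measure_integral => A mA _; exact: XY.
have mEf : measurable_fun setT (EFin \o f) by exact/measurable_EFinP.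
have mA : measurable_fun setT (fun y => `|(EFin \o f) y|%E) by exact: measurableT_comp.
have iEX : P.-integrable setT (EFin \o (f \o X)).
  apply/integrableP; split; first by apply/measurable_EFinP; exact: measurableT_comp.
  have := ge0_integral_distribution X mA (fun y => abse_ge0 _).
  by move=> /= <-; rewrite e ge0_integral_distribution.
have iEY : P.-integrable setT (EFin \o (f \o Y)).
  by apply/integrableP; split => //; apply/measurable_EFinP; exact: measurableT_comp.
split => //.
rewrite -eY; have := integral_distribution mEf iEX.
have := integral_distribution mEf iEY.
by rewrite e => /= -> ->.
Qed.

End HasMean.

(** * Laws of large numbers *)

Section WeakLaw.
Context (R : realType) (disp : measure_display) (T : measurableType disp).
Variable P : probability T R.

(** Chebyshev's inequality: for uncorrelated terms the mean of the squared sum is [d * v], and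
    Markov applies to the square. *)
Lemma second_moment_tail d (Y : 'I_d -> T -> R) (v t : R) : (0 < d)%N -> 0 < t ->
  (forall k l, has_mean P (fun w => Y k w * Y l w) (if k == l then v else 0)) ->
  (P [set w | (t * d%:R <= `|\sum_k Y k w|)%R] <= (v / (t ^+ 2 * d%:R))%:E)%E.
Proof.
move=> d0 t0 hY; have dR : 0 < d%:R :> R by rewrite ltr0n.
have hS : has_mean P (fun w => (\sum_k Y k w) ^+ 2) (d%:R * v).
  have -> : (fun w => (\sum_k Y k w) ^+ 2) = (fun w => \sum_k \sum_l Y k w * Y l w).
    apply/funext => w; rewrite expr2 mulr_suml.
    by apply: eq_bigr => k _; rewrite mulr_sumr.
  have -> : d%:R * v = \sum_(k < d) \sum_(l < d) (if k == l then v else 0).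
    rewrite mulr_natl -[d in LHS]card_ord -sumr_const; apply: eq_bigr => k _.
    rewrite (bigD1 k)//= eqxx big1 ?addr0// => l /negbTE.
    by rewrite eq_sym => ->.
  by apply: has_mean_sum => k; exact: has_mean_sum.
have -> : [set w | t * d%:R <= `|\sum_k Y k w|] =
    [set w | (t * d%:R) ^+ 2 <= (\sum_k Y k w) ^+ 2].
  by apply/funext => w /=; rewrite -[in RHS](@real_normK _ (\sum_k Y k w)) ?num_real//
    ler_pXn2r// nnegrE// mulr_ge0 // ltW.
have -> : v / (t ^+ 2 * d%:R) = d%:R * v / (t * d%:R) ^+ 2.
  by field; rewrite gt_eqF// gt_eqF.
apply: has_mean_markov => //; first by move=> w; exact: sqr_ge0.
by rewrite exprn_gt0// mulr_gt0.
Qed.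

(** Dominated convergence: the truncations at level k increase to the square, which dominates
    them. *)
Lemma truncated_second_moment (X : {RV P >-> R}) (nu tau : R) : 0 < tau ->
  has_mean P (fun w => X w ^+ 2) nu ->
  exists M m : R, [/\ 0 <= M, has_mean P (fun w => Num.min (X w ^+ 2) M) m & nu - m <= tau].
Proof.
move=> tau0 hX.
pose f_ (k : nat) w := (Num.min (X w ^+ 2) k%:R)%:E.
have mX2 := has_mean_measurable hX.
have mf k : measurable_fun setT (fun w => Num.min (X w ^+ 2) k%:R).
  exact: measurable_minr.
have hf k : exists s, has_mean P (fun w => Num.min (X w ^+ 2) k%:R) s.
  apply: has_mean_dominated hX => // w.
  by rewrite ger0_norm ?ge_min ?lexx// le_min sqr_ge0 ler0n.
have [||||| _ _ cvgf] := @dominated_convergence _ T R P setT measurableT f_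
   (fun w => (X w ^+ 2)%:E) (fun w => (X w ^+ 2)%:E).
- by move=> k; apply/measurable_EFinP; exact: mf.
- exact/measurable_EFinP.
- apply: aeW => w _; apply: cvg_near_cst; near=> k.
  rewrite /f_ min_l//; near: k; exact: nbhs_infty_ger.
- exact: hX.1.
- apply: aeW => w k _; rewrite /f_ lee_fin.
  by rewrite ger0_norm ?ge_min ?lexx// le_min sqr_ge0 ler0n.
rewrite hX.2 in cvgf; have /fine_cvgP[_ /cvgr_gt cvgf'] := cvgf.
have [k /= fk] : exists k, nu - tau < fine (\int[P]_w f_ k w)%E.
  apply: (@filter_ex _ \oo); apply: cvgf'; lra.
have [m hm] := hf k; exists k%:R, m; split => //.
by move: fk; rewrite /f_ hm.2 /=; lra.
Unshelve. all: by end_near. Qed.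

(** The truncated squares are bounded and obey Chebyshev's inequality; the nonnegative excess has
    small mean and obeys Markov's. The threshold depends only on the law of [X0]. *)
Lemma weak_law_squares (X0 : {RV P >-> R}) (nu t eps : R) :
  has_mean P (fun w => X0 w ^+ 2) nu -> 0 < t -> 0 < eps ->
  exists D0 : nat, forall d, (D0 < d)%N -> forall Z : 'I_d -> {RV P >-> R},
    (forall k l, k != l -> independent P (Z k) (Z l)) ->
    (forall k (A : set R), measurable A -> distribution P (Z k) A = distribution P X0 A) ->
    (P [set w | (t * d%:R <= `|(\sum_k Z k w ^+ 2) - nu * d%:R|)%R] <= eps%:E)%E.
Proof.
move=> hX0 t0 eps0.
(* [t / 3] bounds the mean lost by truncation, and [eps * t / 6] makes Markov's bound for the excess
   at most [eps / 2]. *)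
pose tau := Num.min (t / 3) (eps * t / 6).
have tau0 : 0 < tau by rewrite lt_min !divr_gt0//= mulr_gt0.
have [M [m [M0 hM nm]]] := truncated_second_moment tau0 hX0.
pose g (x : R) := Num.min (x ^+ 2) M - m.
have mg : measurable_fun setT g.
  apply: measurable_funB; last exact: measurable_cst.
  apply: measurable_minr; last exact: measurable_cst.
  exact: measurable_funX.
pose q (x : R) := x ^+ 2 - Num.min (x ^+ 2) M.
have mq : measurable_fun setT q.
  have msq : measurable_fun setT (fun x : R => x ^+ 2) by exact: measurable_funX.
  by apply: measurable_funB => //; apply: measurable_minr => //; exact: measurable_cst.
have q0 x : 0 <= q x by rewrite subr_ge0 ge_min lexx.
have hg0 : has_mean P (g \o X0) 0.
  by rewrite -(subrr m); apply: has_meanB => //; exact: has_mean_cst.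
have hq0 : has_mean P (q \o X0) (nu - m) by exact: has_meanB.
have [v hv] : exists v, has_mean P (fun w => g (X0 w) * g (X0 w)) v.
  apply: (has_mean_dominated _ _ (has_mean_cst P ((M + `|m|) ^+ 2))).
    apply: measurable_funM; exact: measurableT_comp.
  move=> w; rewrite normrM -expr2 ler_pXn2r ?nnegrE ?addr_ge0//.
  rewrite (le_trans (ler_normB _ _))// lerD2r ger0_norm ?ge_min ?lexx ?orbT//.
  by rewrite le_min sqr_ge0.
have v0 : 0 <= v.
  apply: has_mean_le (has_mean_cst P 0) hv => w.
  by rewrite -expr2 sqr_ge0.
(* Makes Chebyshev's bound at level [t / 3] at most [eps / 2]. *)
pose K := 18 * v / (t ^+ 2 * eps).
exists (Num.trunc K) => d Kd Z indZ lawZ.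
have Kd' : K <= d%:R by rewrite ltW// (lt_le_trans (truncnS_gt _))// ler_nat.
have d_gt0 : (0 < d)%N by case: d Kd {Z indZ lawZ Kd'}.
have dR : 0 < d%:R :> R by rewrite ltr0n.
pose Y k w := g (Z k w).
have mgX : measurable_fun setT (fun x => g x * g x) by exact: measurable_funM.
have hY k l : has_mean P (fun w => Y k w * Y l w) (if k == l then v else 0).
  case: eqVneq => [<-|kl].
    exact: (has_mean_law (f := fun x => g x * g x) (lawZ k) mgX hv).
  have mgZ k' : measurable_fun setT (g \o Z k') by exact: measurableT_comp.
  rewrite -(mulr0 0).
  apply: (@has_mean_indep _ _ _ P (mfun_Sub (mem_set (mgZ k))) (mfun_Sub (mem_set (mgZ l)))).
  - exact: independent_comp (indZ _ _ kl).
  - exact: (has_mean_law (lawZ k) mg hg0).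
  - exact: (has_mean_law (lawZ l) mg hg0).
have hQ : has_mean P (fun w => \sum_k q (Z k w)) (\sum_(k < d) (nu - m)).
  by apply: has_mean_sum => k; exact: (has_mean_law (lawZ k) mq hq0).
have t3 : 0 < t / 3 by rewrite divr_gt0.
have B1 := second_moment_tail d_gt0 t3 hY.
have B2 := @has_mean_markov _ _ _ P _ _ (t / 3 * d%:R)
  (fun w => sumr_ge0 _ (fun k _ => q0 (Z k w))) hQ (mulr_gt0 t3 dR).
have mY k : measurable_fun setT (Y k) by exact: measurableT_comp.
have mE1 : measurable [set w | t / 3 * d%:R <= `|\sum_k Y k w|].
  apply: measurable_superlevel; apply: measurableT_comp => //.
  exact: measurable_sum.
have mE2 : measurable [set w | t / 3 * d%:R <= \sum_k q (Z k w)].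
  by apply: measurable_superlevel; exact: (has_mean_measurable hQ).
apply: (@le_trans _ _ (P ([set w | (t / 3 * d%:R <= `|\sum_k Y k w|)%R] `|`
   [set w | (t / 3 * d%:R <= \sum_k q (Z k w))%R]))).
  apply: le_measure; rewrite ?inE.
  - apply: measurable_superlevel; apply: measurableT_comp => //.
    apply: measurable_funB => //; apply: measurable_sum => k.
    exact: measurable_funX.
  - exact: measurableU.
  move=> w /= hw; apply: contrapT => /not_orP[/negP]; rewrite -ltNge => h1 /negP.
  rewrite -ltNge => h2; move: hw; rewrite leNgt => /negP; apply.
  (* The deviation is the centred truncated part plus the excess minus the lost mean, each at most t
     d / 3 in size outside the two events. *)
  have e : \sum_k Z k w ^+ 2 - nu * d%:R =
      \sum_k Y k w + \sum_k q (Z k w) - (nu - m) * d%:R.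
    have -> : \sum_k Z k w ^+ 2 = \sum_k Y k w + \sum_k q (Z k w) + \sum_(k < d) m.
      by rewrite -!big_split/=; apply: eq_bigr => k _; rewrite /Y /g /q; ring.
    by rewrite sumr_const card_ord -[m *+ d]mulr_natr; ring.
  have h3 : 0 <= \sum_k q (Z k w) by apply: sumr_ge0.
  have h4 : (nu - m) * d%:R <= t / 3 * d%:R.
    by rewrite ler_pM2r// (le_trans nm)// ge_min lexx.
  have h5 : 0 <= (nu - m) * d%:R.
    apply: mulr_ge0; last exact: ltW.
    by rewrite subr_ge0; apply: has_mean_le hM hX0 => w'; rewrite ge_min lexx.
  rewrite e; move: h1; rewrite !ltr_norml => /andP[h1 h1'].
  by apply/andP; split; lra.
apply: (le_trans (measureU2 _ mE1 mE2)).
have -> : eps = eps / 2 + eps / 2 by lra.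
rewrite EFinD; apply: leeD.
  apply: (le_trans B1); rewrite lee_fin ler_pdivrMr; last by rewrite !mulr_gt0 ?exprn_gt0.
  move: Kd'; rewrite /K ler_pdivrMr; last by rewrite mulr_gt0// exprn_gt0.
  by rewrite !expr2; lra.
apply: (le_trans B2); rewrite lee_fin ler_pdivrMr; last by rewrite mulr_gt0.
rewrite sumr_const card_ord -[_ *+ d]mulr_natr mulrA ler_pM2r//.
apply: (le_trans nm); rewrite ge_min; apply/orP; right; lra.
Qed.

(** By independence the products have mean 0 and second moment [nu ^+ 2] and are uncorrelated, so
    Chebyshev's inequality applies without truncation. *)
Lemma weak_law_products d (X Y : 'I_d -> {RV P >-> R}) (nu t : R) :
  (0 < d)%N -> 0 < t ->
  (forall k, has_mean P (X k) 0) ->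
  (forall k, has_mean P (fun w => X k w ^+ 2) nu) ->
  (forall k, has_mean P (fun w => Y k w ^+ 2) nu) ->
  (forall k, independent P (X k) (Y k)) -> (forall k, has_mean P (Y k) 0) ->
  (forall k l, k != l -> independent P (fun w => (X k w, Y k w)) (fun w => (X l w, Y l w))) ->
  (P [set w | (t * d%:R <= `|\sum_k X k w * Y k w|)%R] <= (nu ^+ 2 / (t ^+ 2 * d%:R))%:E)%E.
Proof.
move=> d0 t0 hX hX2 hY2 indXY hY ind4.
have hXY k : has_mean P (fun w => X k w * Y k w) 0.
  by rewrite -(mulr0 0); exact: has_mean_indep.
apply: second_moment_tail => // k l; case: eqVneq => [<-|kl].
  have mX2 : measurable_fun setT (fun w => X k w ^+ 2) by exact: measurable_funX.
  have mY2 : measurable_fun setT (fun w => Y k w ^+ 2) by exact: measurable_funX.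
  have -> : (fun w => X k w * Y k w * (X k w * Y k w)) = (fun w => X k w ^+ 2 * Y k w ^+ 2).
    by apply/funext => w; ring.
  apply: (@has_mean_indep _ _ _ P (mfun_Sub (mem_set mX2)) (mfun_Sub (mem_set mY2))).
  - have msq : measurable_fun setT (fun x : R => x ^+ 2) by exact: measurable_funX.
    exact: (independent_comp msq msq (indXY k)).
  - exact: hX2.
  - exact: hY2.
have mXY j : measurable_fun setT (fun w => X j w * Y j w) by exact: measurable_funM.
rewrite /= -[X in has_mean _ _ X](mulr0 (0 : R)).
apply: (@has_mean_indep _ _ _ P (mfun_Sub (mem_set (mXY k))) (mfun_Sub (mem_set (mXY l)))).
- have mprod : measurable_fun setT (fun z : R * R => z.1 * z.2).
    by apply: measurable_funM; [exact: measurable_fst|exact: measurable_snd].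
  exact: (independent_comp mprod mprod (ind4 _ _ kl)).
- exact: hXY.
- exact: hXY.
Qed.

End WeakLaw.

(** * Asymptotics *)

(** At mean 0 the variance is the integral of the square, and |X| <= X^2 + 1 makes [X]
    integrable. *)
Lemma has_mean_moments (R : realType) (disp : measure_display) (T : measurableType disp)
    (P : probability T R) (X : {RV P >-> R}) (nu : R) :
  ('E_P[X] = 0)%E -> ('V_P[X] = nu%:E)%E ->
  has_mean P X 0 /\ has_mean P (fun w => X w ^+ 2) nu.
Proof.
move=> EX VX.
have h2 : has_mean P (fun w => X w ^+ 2) nu.
  apply: has_mean_ge0; first exact: measurable_funX.
    by move=> w; exact: sqr_ge0.
  rewrite -VX /variance covariance.unlock EX expectation.unlock/=.
  apply: eq_integral => w _; rewrite /= expr2; congr (EFin (_ * _)); exact: (esym (subr0 _)).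
split => //.
have [s hs] : exists s, has_mean P X s.
  apply: (has_mean_dominated _ _ (has_meanD h2 (has_mean_cst P 1))) => // w.
  rewrite -[X w ^+ 2](real_normK (num_real _)).
  by have := sqr_ge0 (`|X w| - 1); have := normr_ge0 (X w); rewrite !expr2; nra.
by move: hs.2 EX; rewrite expectation.unlock => -> [s0]; move: hs; rewrite s0.
Qed.

Lemma bottleneck_ge0 (R : realType) (A B : set ((R * R) * nat)) : A !=set0 ->
  (0 <= bottleneck A B)%E.
Proof.
move=> [q Aq]; apply: le_ereal_inf_tmp => _ [eta _ <-].
apply: (@le_trans _ _ `|q.1 - (eta q).1|%:E); first by rewrite lee_fin.
by apply: ereal_sup_ubound; exists q.
Qed.

Lemma bottleneck_dist_ge0 (R : realType) (F : fieldType) (m N : nat)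
  (X Y : {fset 'cV[R]_m}) : (0 <= bottleneck_dist F N X Y)%E.
Proof. by apply: bottleneck_ge0; exists ((0, 0), 0%N); right. Qed.

Lemma measure_bigsetU_le (R : realType) (disp : measure_display) (T : measurableType disp)
    (P : probability T R) (I : Type) (l : seq I) (B : I -> set T) :
  (forall i, measurable (B i)) ->
  measurable (\big[setU/set0]_(i <- l) B i) /\
  (P (\big[setU/set0]_(i <- l) B i) <= \sum_(i <- l) P (B i))%E.
Proof.
move=> mB; have mU (s : seq I) : measurable (\big[setU/set0]_(i <- s) B i).
  by elim: s => [|i s IH]; rewrite ?big_nil ?big_cons//; exact: measurableU.
split=> //; elim: l => [|i l IH]; first by rewrite !big_nil measure0.
rewrite !big_cons; apply: (le_trans (measureU2 _ _ _)) => //.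
exact: leeD2l.
Qed.

(** * Probability estimates for the upper and lower bounds *)

Section Main.
Variables (R : realType) (F : fieldType) (n s : nat) (x : 'M[R]_(s, n)).
Variables (disp : measure_display) (T : measurableType disp) (P : probability T R).
Variables (nu : R) (e : forall d : nat, 'I_n -> 'I_d -> {RV P >-> R}) (X0 : {RV P >-> R}).
Arguments e : clear implicits.
Hypothesis nu_gt0 : 0 < nu.
Hypothesis e_indep : forall d, (n < d)%N ->
  mutually_independent (fun ik : 'I_n * 'I_d => e d ik.1 ik.2).
Hypothesis e_law : forall d, (n < d)%N -> forall i k (A : set R), measurable A ->
  distribution P (e d i k) A = distribution P X0 A.
Hypothesis X0_mean : has_mean P X0 0.
Hypothesis X0_sq : has_mean P (fun w => X0 w ^+ 2) nu.

Let dB N d w := bottleneck_dist F N (orig_cloud x d)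
  (observed_cloud x (fun i k => e d i k w)).

Let e_mean d i k : (n < d)%N -> has_mean P (e d i k) 0.
Proof.
move=> nd; apply: (has_mean_law (f := id) (e_law nd i k)) => //.
Qed.

Let e_sq d i k : (n < d)%N -> has_mean P (fun w => e d i k w ^+ 2) nu.
Proof.
move=> nd; apply: (has_mean_law (f := fun x => x ^+ 2) (e_law nd i k)) => //.
Qed.

Let total_sq d w := \sum_i \sum_k e d i k w ^+ 2.

Let total_sq_mean d : (n < d)%N -> has_mean P (total_sq d) (n%:R * d%:R * nu).
Proof.
move=> nd; have -> : n%:R * d%:R * nu = \sum_(i < n) \sum_(k < d) nu.
  by rewrite !sumr_const !card_ord -(mulr_natl nu d) -(mulr_natl (d%:R * nu) n) mulrA.
by apply: has_mean_sum => i; apply: has_mean_sum => k; exact: e_sq.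
Qed.

(** Markov's inequality for the total squared noise bounds all noise vectors at once; the quotient
    by sqrt d is then bounded by a constant. *)
Lemma bottleneck_dist_bigO N : (0 < n)%N ->
  bigO_prob P (fun d => Num.sqrt d%:R) (dB N).
Proof.
move=> n_gt0; exists (fun d w => ((Num.sqrt d%:R)^-1%:E * dB N d w)%E); split; last first.
  exists 1%N => // d /= d1 w; rewrite muleA -EFinM mulfV ?mul1e//.
  by rewrite gt_eqF// sqrtr_gt0 ltr0n.
move=> eps eps0; pose rho := sqnorm_total x.
have rho0 : 0 <= rho := sqnorm_total_ge0 x.
(* Markov's bound at level [K * d] is then exactly [eps]. *)
pose K := n%:R * nu / eps.
have nR : 0 < n%:R :> R by rewrite ltr0n.
have K0 : 0 < K by rewrite divr_gt0// mulr_gt0.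
exists (Num.sqrt (2 * rho + 2 * K)), n => d nd.
have d_gt0 : (0 < d)%N by exact: leq_ltn_trans nd.
have dR : 0 < d%:R :> R by rewrite ltr0n.
have d1 : 1 <= d%:R :> R by rewrite ler1n.
have hm := total_sq_mean nd.
have t0 w : 0 <= total_sq d w.
  by apply: sumr_ge0 => i _; apply: sumr_ge0 => k _; exact: sqr_ge0.
have mB : measurable [set w | K * d%:R <= total_sq d w].
  by apply: measurable_superlevel; exact: has_mean_measurable hm.
exists (~` [set w | K * d%:R <= total_sq d w]); split; first exact: measurableC.
  move=> w /= /negP; rewrite -ltNge => hw.
  rewrite gee0_abs ?mule_ge0 ?bottleneck_dist_ge0 ?lee_fin ?invr_ge0 ?sqrtr_ge0//.
  rewrite lee_pdivrMl ?sqrtr_gt0// -EFinM.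
  apply: le_trans (bottleneck_dist_cloud_le F x N (S := K * d%:R) _ _) _.
  - by rewrite mulr_ge0 // ltW.
  - move=> i; apply: le_trans (ltW hw); rewrite /total_sq (bigD1 i)//=.
    have -> : dotv (noise_vec (fun i k => e d i k w) i) (noise_vec (fun i k => e d i k w) i)
        = \sum_k e d i k w ^+ 2.
      by apply: eq_bigr => k _; rewrite !mxE expr2.
    rewrite lerDl; apply: sumr_ge0 => j _; apply: sumr_ge0 => k _; exact: sqr_ge0.
  rewrite lee_fin -sqrtrM ?ler0n// ler_wsqrtr// -/rho.
  have : rho <= d%:R * rho by rewrite ler_peMl.
  by lra.
rewrite probability_setC// EFinB leeB//.
apply: (le_trans (has_mean_markov t0 hm _)); first by rewrite mulr_gt0.
rewrite lee_fin ler_pdivrMr; last by rewrite mulr_gt0.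
by rewrite le_eqVlt; apply/orP; left; apply/eqP; rewrite /K; field; rewrite gt_eqF.
Qed.

Let bad (t : R) d (ij : 'I_n * 'I_n) : set T :=
  [set w | t * d%:R <= `|(\sum_k e d ij.1 k w * e d ij.2 k w)
     - (ij.1 == ij.2)%:R * (nu * d%:R)|].

Let bad_measurable t d ij : measurable (bad t d ij).
Proof.
apply: measurable_superlevel; apply: measurableT_comp => //.
apply: measurable_funB => //; apply: measurable_sum => k.
exact: measurable_funM.
Qed.

(** The case i = j is the weak law for squares, the other that for products; the threshold covers
    both and so serves all pairs. *)
Let bad_small t eps : 0 < t -> 0 < eps -> exists D0 : nat, forall d, (D0 < d)%N ->
  forall ij, (P (bad t d ij) <= eps%:E)%E.
Proof.
move=> t0 eps0; have [D1 hD1] := weak_law_squares X0_sq t0 eps0.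
pose K := nu ^+ 2 / (t ^+ 2 * eps).
exists (maxn (maxn n D1) (Num.trunc K)) => d; rewrite !gtn_max => /andP[/andP[nd D1d] Kd] [i j].
have K_le : K <= d%:R by rewrite ltW// (lt_le_trans (truncnS_gt _))// ler_nat.
have d_gt0 : (0 < d)%N by exact: leq_ltn_trans nd.
have dR : 0 < d%:R :> R by rewrite ltr0n.
have ind := e_indep nd.
have [ij|ij] := eqVneq i j.
  rewrite /bad /= -ij eqxx mul1r.
  under eq_set => w do under eq_bigr => k _ do rewrite -expr2.
  apply: hD1 => // [k l kl|k A mA]; last exact: e_law.
  apply: (mutually_independent2 ind (p := (i, k)) (q := (i, l))).
  by apply: contra kl => /eqP[->].
rewrite /bad /= (negPf ij) mul0r.
under eq_set => w do rewrite subr0.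
apply: (le_trans (weak_law_products (nu := nu) d_gt0 t0 _ _ _ _ _ _)).
- by move=> k; exact: e_mean.
- by move=> k; exact: e_sq.
- by move=> k; exact: e_sq.
- move=> k; apply: (mutually_independent2 ind (p := (i, k)) (q := (j, k))).
  by apply: contra ij => /eqP[->].
- by move=> k; exact: e_mean.
- move=> k l kl; apply: (mutually_independent4 ind (p := (i, k)) (q := (j, k)) (p' := (i, l)) (q' := (j, l))).
  rewrite /= !inE !xpair_eqE !eqxx (eq_sym j i) (negbTE ij) (negbTE kl) //.
rewrite lee_fin ler_pdivrMr ?mulr_gt0 ?exprn_gt0//.
move: K_le; rewrite /K ler_pdivrMr ?mulr_gt0 ?exprn_gt0//.
by move=> /le_trans; apply; rewrite le_eqVlt; apply/orP; left; apply/eqP; ring.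
Qed.

(** Given a candidate bound [C] for probability 1/2, the event that the distance is at most [C]
    lies, for some large [d], in a union of bad events of probability at most 1/4. *)
Lemma bottleneck_dist_unbounded N : (N.+2 <= n)%N -> unbounded_in_prob P (dB N).
Proof.
move=> Nn H.
have half0 : 0 < 2^-1 :> R by rewrite invr_gt0 ltr0n.
have [C [M HC]] := H _ half0.
have C0 : 0 < `|C| + 1 by rewrite ltr_wpDl.
have [M1 HM1] := bottleneck_dist_cloud_ge F x Nn nu_gt0 C0.
have n_gt0 : (0 < n)%N by exact: leq_trans Nn.
have nR : 1 <= n%:R :> R by rewrite ler1n.
(* There are n^2 bad events, so their probabilities add up to at most 1/4. *)
pose eps : R := (4 * (n%:R * n%:R))^-1.
have eps0 : 0 < eps by rewrite invr_gt0 !mulr_gt0// ltr0n.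
have t0 := noise_tol_gt0 N nu_gt0.
have [D0 HD0] := bad_small t0 eps0.
pose d := (maxn M (maxn M1 D0)).+1.
have Md : (M < d)%N by rewrite ltnS leq_maxl.
have M1d : (M1 < d)%N by rewrite ltnS (leq_trans (leq_maxl _ D0))// leq_maxr.
have D0d : (D0 < d)%N by rewrite ltnS (leq_trans (leq_maxr M1 _))// leq_maxr.
have [mA PA] := measure_bigsetU_le P (index_enum ('I_n * 'I_n)%type)
  (bad_measurable (noise_tol N nu) d).
have /(_ _ mA) := HC d Md.
(* Outside all bad events the deterministic bound puts the distance at [|C| + 1] or more. *)
have sub : [set w | (`|dB N d w| <= C%:E)%E] `<=`
    \big[setU/set0]_(ij : 'I_n * 'I_n) bad (noise_tol N nu) d ij.
  move=> w /= dBw; apply: contrapT => nw.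
  have good ij : ~ bad (noise_tol N nu) d ij w.
    by move=> b; apply: nw; rewrite (bigD1 ij)//=; left.
  have : ((`|C| + 1)%:E <= dB N d w)%E.
    apply: HM1 => // i j; have := good (i, j); rewrite /bad /= => /negP.
    rewrite -ltNge => /ltW; congr (`|_ - _| <= _).
    by apply: eq_bigr => k _; rewrite !mxE.
  move=> /le_trans /(_ (lee_abs _)) /le_trans /(_ dBw).
  by rewrite lee_fin; have := ler_norm C; lra.
move=> /(_ sub) /le_trans /(_ PA) h.
have : ((1 - 2^-1)%:E <= (4^-1 : R)%:E)%E.
  apply: (le_trans h); apply: (@le_trans _ _ (\sum_(ij : 'I_n * 'I_n) eps%:E)%E).
    by apply: lee_sum => ij _; exact: HD0.
  rewrite sumEFin lee_fin sumr_const card_prod !card_ord -[_ *+ _]mulr_natr natrM /eps.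
  rewrite le_eqVlt; apply/orP; left; apply/eqP; field.
  by rewrite gt_eqF// (lt_le_trans _ nR).
by rewrite lee_fin; lra.
Qed.

End Main.

Unset Implicit Arguments.

Theorem mainTheorem2 (R : realType) (F : fieldType)
    (n s : nat) (hn : (3 < n)%N) (hs : (1 <= s < n)%N) (x : 'M[R]_(s, n))
    (disp : measure_display) (T : measurableType disp) (P : probability T R)
    (mu : probability (measurableTypeR R) R) (nu : R)
    (e : forall d : nat, 'I_n -> 'I_d -> {RV P >-> R})
    (hmu : mu `<< @lebesgue_measure R)
    (hnu : 0 < nu)
    (he_indep : forall d, (n < d)%N ->
       mutually_independent (fun ik : 'I_n * 'I_d => e d ik.1 ik.2))
    (he_law : forall d, (n < d)%N -> forall i k (A : set R), measurable A ->
       distribution P (e d i k) A = mu A)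
    (he_mean : forall d, (n < d)%N -> forall i k, ('E_P[e d i k] = 0)%E)
    (he_var : forall d, (n < d)%N -> forall i k, ('V_P[e d i k] = nu%:E)%E)
    (N : nat) (hN : (N <= n - 2)%N) :
  let dB := fun (d : nat) (w : T) =>
    bottleneck_dist F N (orig_cloud x d)
                        (observed_cloud x (fun i k => e d i k w)) in
  bigO_prob P (fun d => Num.sqrt d%:R) dB /\ unbounded_in_prob P dB.
Proof.
move=> dB.
have n_gt0 : (0 < n)%N by exact: leq_trans hn.
(* One noise coordinate in the smallest admissible dimension, [n.+1], serves as the reference for
   the common law. *)
pose X0 : {RV P >-> R} := e n.+1 (Ordinal n_gt0) ord0.
have e_law d : (n < d)%N -> forall i k (A : set R), measurable A ->
    distribution P (e d i k) A = distribution P X0 A.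
  by move=> nd i k A mA; rewrite he_law// -(he_law n.+1 (ltnSn n) (Ordinal n_gt0) ord0).
have [X0_mean X0_sq] := has_mean_moments (he_mean _ (ltnSn n) _ _)
  (he_var _ (ltnSn n) (Ordinal n_gt0) ord0).
split.
  exact: (@bottleneck_dist_bigO _ F _ _ x _ _ P nu e X0).
apply: (@bottleneck_dist_unbounded _ F _ _ x _ _ P nu e X0) => //.
by lia.
Qed.
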